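(* On $\mathbb{R}^5$ with coordinates $(\theta,\phi,x,q,\psi)$ let $$V^1=\partial_\theta+\cos(\psi)\partial_x+\sin(\psi)\left(e^{-\frac{x}{3}}\partial_{q}-\tfrac{1}{3}\partial_{\psi}\right),$$ $$V^2=e^{-\theta}\partial_\phi+\partial_\psi-\sin(\psi)\partial_{x}+\cos(\psi)\left(e^{-\frac{x}{3}}\partial_{q}-\tfrac{1}{3}\partial_{\psi}\right),$$ $$X^1=\cos(\psi)V^1-\sin(\psi)V^2,\qquad X^2=\cos(\psi) V^2+\sin(\psi) V^1,$$ $$Z^1=\tfrac{3}{2}\partial_q-3e^{\frac{x}{3}}\partial_{\psi}+3e^{\frac{x}{3}}\left(\sin(\psi)\partial_\theta+\cos(\psi)(e^{-\theta}\partial_{\phi}+\partial_{\psi})\right),$$ and define the vector fields $$S^2=-\tfrac{3}{2}\cos(\tfrac{\psi}{2})e^{\frac{\theta}{2}+\frac{x}{6}}X^1-3\sin(\tfrac{\psi}{2})e^{\frac{\theta}{2}+\frac{x}{6}}X^2,$$ $$S^1=\tfrac{3}{4}\sin(\tfrac{\psi}{2})e^{\frac{x}{6}-\frac{\theta}{2}}X^1-\tfrac{3}{2}\cos(\tfrac{\psi}{2})e^{\frac{x}{6}-\frac{\theta}{2}}X^2+\tfrac{1}{2}\phi S^2,$$ $$S^3=4qX^1+6e^{-\frac{x}{3}}X^2-\tfrac{4}{9}q^2 Z^1.$$ Then $S^1,S^2,S^3$ pairwise bracket-generate the Lie algebra of split $\mathfrak{g}_2$.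
   Context: Three vector fields $S^1,S^2,S^3$ are said to pairwise bracket-generate the Lie algebra of split $\mathfrak{g}_2$ if the following holds. Define by Lie brackets of vector fields $$S^4:=[S^1,S^2],\quad S^5:=[S^2,S^3],\quad S^6:=[S^3,S^1],$$ $$L^1:=[S^1,S^4],\quad L^3:=[S^2,S^5],\quad L^5:=[S^3,S^6],$$ $$L^2:=[S^4,S^2],\quad L^4:=[S^5,S^3],\quad L^6:=[S^6,S^1],$$ $$H:=[S^2,S^6],\qquad h:=[S^4,S^3].$$ Then the 14 vector fields $$S^1,\dots,S^6,\ \tfrac14(h-H),\ \tfrac{\sqrt3}{12}(h+H),\ L^1,\dots,L^6$$ form (i.e. are a basis, over $\mathbb{R}$, of) a 14-dimensional Lie algebra under the Lie bracket of vector fields, isomorphic to the split real form of the exceptional simple Lie algebra $\mathfrak{g}_2$. *)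

(* Defs.v *)
From mathcomp Require Import all_boot all_order all_algebra.
From mathcomp Require Import all_classical all_reals all_analysis.
Set Implicit Arguments.
Unset Strict Implicit.
Unset Printing Implicit Defensive.
Import Order.TTheory GRing.Theory Num.Theory.
Import numFieldNormedType.Exports.
Local Open Scope classical_set_scope.
Local Open Scope ring_scope.

(* Lie algebras are carried by a subset A of an ambient vector space V, with a
   bracket defined on all of V: the bracket of vector fields below is a total
   operation but is a Lie bracket only on smooth fields, and the axioms are
   required on A only. *)
Record lie_algebra (R : pzRingType) (V : lmodType R) (br : V -> V -> V)
    (A : set V) : Prop := LieAlgebra {
  lie_mem0 : A 0 ;
  lie_memP : forall k x y, A x -> A y -> A (k *: x + y) ;
  lie_mem_br : forall x y, A x -> A y -> A (br x y) ;
  lie_brPl : forall k x y z, A x -> A y -> A z ->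
    br (k *: x + y) z = k *: br x z + br y z ;
  lie_brPr : forall k x y z, A x -> A y -> A z ->
    br z (k *: x + y) = k *: br z x + br z y ;
  lie_brxx : forall x, A x -> br x x = 0 ;
  lie_jacobi : forall x y z, A x -> A y -> A z ->
    br x (br y z) + br y (br z x) + br z (br x y) = 0
}.

Definition lie_isomorphic (R : pzRingType) (V W : lmodType R)
    (brV : V -> V -> V) (A : set V) (brW : W -> W -> W) (B : set W) : Prop :=
  exists f : V -> W,
    [/\ set_bij A B f,
        forall k x y, A x -> A y -> f (k *: x + y) = k *: f x + f y
      & forall x y, A x -> A y -> f (brV x y) = brW (f x) (f y)].

Definition lincomb (R : pzRingType) (V : lmodType R) (n : nat)
    (B : n.-tuple V) (c : 'I_n -> R) : V :=
  \sum_(i < n) c i *: tnth B i.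

Definition linspan (R : pzRingType) (V : lmodType R) (n : nat)
    (B : n.-tuple V) : set V := range (lincomb B).

Definition lin_indep (R : pzRingType) (V : lmodType R) (n : nat)
    (B : n.-tuple V) : Prop :=
  forall c : 'I_n -> R, lincomb B c = 0 -> forall i, c i = 0.

Section SplitG2.
Variable R : comNzRingType.

Definition dot3 (u v : 'rV[R]_3) : R := \sum_(i < 3) u 0 i * v 0 i.

(* Indices are taken modulo 3. *)
Definition cross3 (u v : 'rV[R]_3) : 'rV[R]_3 :=
  \row_(i < 3) (u 0 (i + 1) * v 0 (i + 2) - u 0 (i + 2) * v 0 (i + 1)).

(* Split octonions as Zorn's vector matrices: (a, u, v, b) stands for
     / a u \
     \ v b /   with a, b scalars and u, v vectors of length 3. *)
Local Notation zorn := (R^o * 'rV[R]_3 * 'rV[R]_3 * R^o)%type.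

Definition zorn_mul (x y : zorn) : zorn :=
  let: (a, u, v, b) := x in
  let: (a', u', v', b') := y in
  (a * a' + dot3 u v',
   a *: u' + b' *: u - cross3 v v',
   a' *: v + b *: v' + cross3 u u',
   b * b' + dot3 v u').

Definition is_derivation (V : lmodType R) (mul : V -> V -> V) (D : V -> V)
    : Prop :=
  linear D /\ forall x y, D (mul x y) = mul (D x) y + mul x (D y).

Definition commutator (V : lmodType R) (D E : V -> V) : V -> V :=
  fun x => D (E x) - E (D x).

(* The split real form of g2 is the Lie algebra of derivations of the split
   octonions, under the commutator. *)
Definition split_g2 : set (zorn -> zorn) := [set D | is_derivation zorn_mul D].

End SplitG2.

Section VectorFields.
Variables (R : realType) (n : nat).
Local Notation vfield := ('rV[R]_n -> 'rV[R]_n).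

Definition partial (j : 'I_n) (f : 'rV[R]_n -> R) : 'rV[R]_n -> R :=
  fun p => 'D_(delta_mx 0 j) f p.

Definition coord (X : vfield) (i : 'I_n) : 'rV[R]_n -> R := fun p => X p 0 i.

Definition smooth_fun (f : 'rV[R]_n -> R) : Prop :=
  forall (s : seq 'I_n) (p : 'rV[R]_n), differentiable (foldr partial f s) p.

Definition smooth_vfield (X : vfield) : Prop :=
  forall i, smooth_fun (coord X i).

Definition vbracket (X Y : vfield) : vfield := fun p =>
  \row_(i < n) \sum_(j < n)
    (coord X j p * partial j (coord Y i) p
     - coord Y j p * partial j (coord X i) p).

Definition fscale (f : 'rV[R]_n -> R) (X : vfield) : vfield :=
  fun p => f p *: X p.

Definition bracket_frame (S1 S2 S3 : vfield) : 14.-tuple vfield :=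
  let S4 := vbracket S1 S2 in
  let S5 := vbracket S2 S3 in
  let S6 := vbracket S3 S1 in
  let L1 := vbracket S1 S4 in
  let L3 := vbracket S2 S5 in
  let L5 := vbracket S3 S6 in
  let L2 := vbracket S4 S2 in
  let L4 := vbracket S5 S3 in
  let L6 := vbracket S6 S1 in
  let H := vbracket S2 S6 in
  let h := vbracket S4 S3 in
  [tuple S1; S2; S3; S4; S5; S6;
         (1 / 4 : R) *: (h - H);
         (Num.sqrt 3 / 12 : R) *: (h + H);
         L1; L2; L3; L4; L5; L6].

Definition pairwise_bracket_generates_split_g2 (S1 S2 S3 : vfield) : Prop :=
  let B := bracket_frame S1 S2 S3 in
  [/\ [/\ smooth_vfield S1, smooth_vfield S2 & smooth_vfield S3],
      lin_indep B,
      lie_algebra vbracket (linspan B)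
    & lie_isomorphic vbracket (linspan B)
        (@commutator R _) (@split_g2 R)].

End VectorFields.

Declare Scope vfield_scope.
Notation "f ** X" := (fscale f X) (at level 40, left associativity)
  : vfield_scope.

Section Fields.
Variable R : realType.
Local Notation pt := 'rV[R]_5.
Local Notation vfield := (pt -> pt).
Local Open Scope vfield_scope.

Definition c_theta (p : pt) : R := p 0 (inord 0).
Definition c_phi (p : pt) : R := p 0 (inord 1).
Definition c_x (p : pt) : R := p 0 (inord 2).
Definition c_q (p : pt) : R := p 0 (inord 3).
Definition c_psi (p : pt) : R := p 0 (inord 4).

Definition d_ (j : nat) : vfield := fun _ => delta_mx 0 (inord j).
Definition d_theta := d_ 0.
Definition d_phi := d_ 1.
Definition d_x := d_ 2.
Definition d_q := d_ 3.
Definition d_psi := d_ 4.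

Definition V1 : vfield :=
  d_theta + (fun p => cos (c_psi p)) ** d_x
  + (fun p => sin (c_psi p)) **
      ((fun p => expR (- (c_x p / 3))) ** d_q - (1 / 3 : R) *: d_psi).

Definition V2 : vfield :=
  (fun p => expR (- c_theta p)) ** d_phi + d_psi
  - (fun p => sin (c_psi p)) ** d_x
  + (fun p => cos (c_psi p)) **
      ((fun p => expR (- (c_x p / 3))) ** d_q - (1 / 3 : R) *: d_psi).

Definition X1 : vfield :=
  (fun p => cos (c_psi p)) ** V1 - (fun p => sin (c_psi p)) ** V2.

Definition X2 : vfield :=
  (fun p => cos (c_psi p)) ** V2 + (fun p => sin (c_psi p)) ** V1.

Definition Z1 : vfield :=
  (3 / 2 : R) *: d_q - (fun p => 3 * expR (c_x p / 3)) ** d_psi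
  + (fun p => 3 * expR (c_x p / 3)) **
      ((fun p => sin (c_psi p)) ** d_theta
       + (fun p => cos (c_psi p)) **
           ((fun p => expR (- c_theta p)) ** d_phi + d_psi)).

Definition S2 : vfield :=
  (fun p => - (3 / 2) * cos (c_psi p / 2) * expR (c_theta p / 2 + c_x p / 6)) ** X1
  - (fun p => 3 * sin (c_psi p / 2) * expR (c_theta p / 2 + c_x p / 6)) ** X2.

Definition S1 : vfield :=
  (fun p => 3 / 4 * sin (c_psi p / 2) * expR (c_x p / 6 - c_theta p / 2)) ** X1
  - (fun p => 3 / 2 * cos (c_psi p / 2) * expR (c_x p / 6 - c_theta p / 2)) ** X2
  + (fun p => 1 / 2 * c_phi p) ** S2.

Definition S3 : vfield :=
  (fun p => 4 * c_q p) ** X1 + (fun p => 6 * expR (- (c_x p / 3))) ** X2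
  - (fun p => 4 / 9 * c_q p ^+ 2) ** Z1.

End Fields.

Arguments S1 R : clear implicits.
Arguments S2 R : clear implicits.
Arguments S3 R : clear implicits.

(* Main.v *)
(* The split octonions have three derivations D_k, one for each unit vector e_k
   of R^3, and the 14 iterated brackets of D_0, D_1, D_2 have exactly the same
   structure constants as those of S^1, S^2, S^3.  Matching the two families is
   therefore a linear isomorphism compatible with the brackets, and every Lie
   algebra axiom on the side of vector fields is inherited from the commutator
   of derivations.

   The brackets of the vector fields are computed symbolically.  All their
   components are rational combinations of monomials in exp(theta/2), exp(x/6),
   phi, q, cos(psi/2), sin(psi/2), a ring stable under partial derivatives.
   They are linearly independent because 14 of their Taylor coefficients at the
   origin form an invertible matrix.  That the brackets of the D_k span all
   derivations comes from 14 matrix entries of a derivation that determine it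
   and that form an invertible matrix on those brackets. *)
Require Import Defs.
From Stdlib Require Import BinInt.
From Stdlib Require QArith_base Qreduction.
From mathcomp Require Import all_boot all_order all_algebra.
From mathcomp Require Import all_classical all_reals all_analysis.
From mathcomp Require Import ring lra zify ssrZ.
From mathcomp.algebra_tactics Require Import common.
Set Implicit Arguments.
Unset Strict Implicit.
Unset Printing Implicit Defensive.
Import Order.TTheory GRing.Theory Num.Theory.
Import numFieldNormedType.Exports.
Local Open Scope classical_set_scope.
Local Open Scope ring_scope.

Local Notation Z := BinNums.Z.
Local Notation Q := QArith_base.Q.
Local Notation Qmake := QArith_base.Qmake.
Local Notation Qplus := QArith_base.Qplus.
Local Notation Qmult := QArith_base.Qmult.
Local Notation Qopp := QArith_base.Qopp.
Local Notation Qred := Qreduction.Qred.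
Local Notation Qeq_bool := QArith_base.Qeq_bool.
Local Notation Q0 := (Qmake 0 1).
#[local] Arguments Qreduction.Qred : simpl never.
#[local] Arguments QArith_base.Qplus : simpl never.
#[local] Arguments QArith_base.Qmult : simpl never.
#[local] Arguments QArith_base.Qopp : simpl never.
#[local] Arguments BinInt.Z.of_nat : simpl never.

(** * Linear combinations and spans of a finite family *)

Section Lincomb.
Variables (R : pzRingType) (V : lmodType R) (n : nat) (B : n.-tuple V).

Lemma lincombP k c d :
  k *: lincomb B c + lincomb B d = lincomb B (fun i => k * c i + d i).
Proof.
rewrite /lincomb scaler_sumr -big_split /=; apply: eq_bigr => i _.
by rewrite scalerA scalerDl.
Qed.

Lemma lincomb_delta i : lincomb B (fun j => (j == i)%:R) = tnth B i.
Proof.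
rewrite /lincomb (bigD1 i) //= eqxx scale1r big1 ?addr0 // => j /negbTE ->.
by rewrite scale0r.
Qed.

Lemma lincomb_inj : lin_indep B ->
  forall c d, lincomb B c = lincomb B d -> c =1 d.
Proof.
move=> indep c d e i.
have /indep/(_ i)/eqP : lincomb B (fun i => (-1) * d i + c i) = 0.
  by rewrite -lincombP e scaleN1r addNr.
by rewrite mulN1r addrC subr_eq0 => /eqP.
Qed.

Lemma linspan_lincomb c : linspan B (lincomb B c).
Proof. by exists c. Qed.

Lemma linspan_tnth i : linspan B (tnth B i).
Proof. by rewrite -lincomb_delta; apply: linspan_lincomb. Qed.

Lemma linspanP k x y : linspan B x -> linspan B y -> linspan B (k *: x + y).
Proof. by move=> [c _ <-] [d _ <-]; rewrite lincombP; apply: linspan_lincomb. Qed.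

Lemma linspan0 : linspan B 0.
Proof.
exists (fun=> 0) => //; rewrite /lincomb big1 // => i _.
by rewrite scale0r.
Qed.

End Lincomb.

(** * Transfer of Lie structure between frames with equal structure constants *)

Section Transfer.
Variables (R : comPzRingType) (V W : lmodType R) (n : nat).
Variables (BV : n.-tuple V) (BW : n.-tuple W).

(** Linearity is asked on [A] only: the bracket of vector fields can fail to be additive on fields
    that are not differentiable. *)
Definition bilinear_on (U : lmodType R) (br : U -> U -> U) (A : set U) : Prop :=
  (forall k x y z, A x -> A y -> A z ->
    br (k *: x + y) z = k *: br x z + br y z) /\
  (forall k x y z, A x -> A y -> A z ->
    br z (k *: x + y) = k *: br z x + br z y).

(** Since [g] is linear only on the span, the induction over the sum carries along that the partial
    sums stay in the span. *)
Lemma linear_on_lincomb (U U' : lmodType R) (B : n.-tuple U) (g : U -> U') c :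
  (forall k x y, linspan B x -> linspan B y -> g (k *: x + y) = k *: g x + g y) ->
  g (lincomb B c) = \sum_(i < n) c i *: g (tnth B i).
Proof.
move=> gP.
have g0 : g 0 = 0.
  have := gP (-1) _ _ (linspan0 B) (linspan0 B).
  by rewrite scaler0 addr0 scaleN1r addNr.
suff [] : linspan B (lincomb B c) /\
    g (lincomb B c) = \sum_(i < n) c i *: g (tnth B i) by [].
rewrite /lincomb; apply: (big_ind2 (fun x y => linspan B x /\ g x = y)).
- by split; [exact: linspan0|].
- move=> x1 y1 x2 y2 [A1 <-] [A2 <-]; split.
    by rewrite -[x1]scale1r; apply: linspanP.
  by rewrite -[x1 in LHS]scale1r gP // scale1r.
- move=> i _; split.
    by rewrite -[_ *: _]addr0; apply: linspanP; [exact: linspan_tnth|exact: linspan0].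
  rewrite -[X in g X]addr0 gP ?g0 ?addr0 //; [exact: linspan_tnth|exact: linspan0].
Qed.

Lemma bilinear_lincomb (U : lmodType R) (br : U -> U -> U) (B : n.-tuple U)
    (t : 'I_n -> 'I_n -> 'I_n -> R) :
  bilinear_on br (linspan B) ->
  (forall i j, br (tnth B i) (tnth B j) = lincomb B (t i j)) ->
  forall c d, br (lincomb B c) (lincomb B d) =
    lincomb B (fun k => \sum_(i < n) c i * \sum_(j < n) d j * t i j k).
Proof.
move=> [brl brr] brt c d.
rewrite (@linear_on_lincomb _ _ _ (br^~ (lincomb B d))); last first.
  by move=> k x y Ax Ay; apply: brl => //; apply: linspan_lincomb.
rewrite [RHS]/lincomb.
under [RHS]eq_bigr do rewrite scaler_suml.
rewrite exchange_big /=; apply: eq_bigr => i _.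
rewrite (@linear_on_lincomb _ _ _ (br (tnth B i))); last first.
  by move=> k x y Ax Ay; apply: brr => //; apply: linspan_tnth.
rewrite scaler_sumr.
under [RHS]eq_bigr do rewrite -scalerA scaler_suml scaler_sumr.
rewrite exchange_big /=; apply: eq_bigr => j _.
rewrite brt /lincomb !scaler_sumr; apply: eq_bigr => k _.
by rewrite !scalerA mulrA.
Qed.

(** Matching the two frames gives, by independence, a linear bijection of the spans, and equal
    structure constants make it respect brackets. Closure of the first span is read off the
    constants; alternation and the Jacobi identity are pulled back along the injective map. *)
Lemma lie_isomorphic_frames (brV : V -> V -> V) (brW : W -> W -> W)
    (t : 'I_n -> 'I_n -> 'I_n -> R) :
  lin_indep BV -> lin_indep BW ->
  bilinear_on brV (linspan BV) ->
  lie_algebra brW (linspan BW) ->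
  (forall i j, brV (tnth BV i) (tnth BV j) = lincomb BV (t i j)) ->
  (forall i j, brW (tnth BW i) (tnth BW j) = lincomb BW (t i j)) ->
  lie_algebra brV (linspan BV) /\
  lie_isomorphic brV (linspan BV) brW (linspan BW).
Proof.
move=> iV iW bilV lieW tV tW.
have bilW : bilinear_on brW (linspan BW) by split; case: lieW.
(* Coordinates are chosen classically: independence makes them unique on the span, and the default
   off the span is [0]. *)
pose coef x : 'I_n -> R := xget 0 [set c | lincomb BV c = x].
pose f x := lincomb BW (coef x).
have fE c : f (lincomb BV c) = lincomb BW c.
  rewrite /f; congr lincomb; apply/funext; apply: (lincomb_inj iV).
  exact: (xgetPex 0 (ex_intro (fun d => lincomb BV d = lincomb BV c) c erefl)).
have fP k x y : linspan BV x -> linspan BV y -> f (k *: x + y) = k *: f x + f y.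
  by move=> [c _ <-] [d _ <-]; rewrite lincombP !fE lincombP.
have memV x y : linspan BV x -> linspan BV y -> linspan BV (brV x y).
  by move=> [c _ <-] [d _ <-]; rewrite (bilinear_lincomb bilV tV); apply: linspan_lincomb.
have fbr x y : linspan BV x -> linspan BV y -> f (brV x y) = brW (f x) (f y).
  move=> [c _ <-] [d _ <-].
  by rewrite (bilinear_lincomb bilV tV) !fE (bilinear_lincomb bilW tW).
have fmem x : linspan BV x -> linspan BW (f x).
  by move=> [c _ <-]; rewrite fE; apply: linspan_lincomb.
have finj x y : linspan BV x -> linspan BV y -> f x = f y -> x = y.
  by move=> [c _ <-] [d _ <-]; rewrite !fE => /(lincomb_inj iW)/funext ->.
have V0 := linspan0 BV.
have f0 : f 0 = 0.
  by have := fP (-1) _ _ V0 V0; rewrite scaler0 addr0 scaleN1r addNr.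
have fD x y : linspan BV x -> linspan BV y -> f (x + y) = f x + f y.
  by move=> Ax Ay; rewrite -[x in LHS]scale1r fP // scale1r.
have VD x y : linspan BV x -> linspan BV y -> linspan BV (x + y).
  by move=> Ax Ay; rewrite -[x]scale1r; apply: linspanP.
case: bilV => brl brr.
split.
  split => //; first exact: linspanP.
  - by move=> x Ax; apply: finj; rewrite ?fbr ?f0 ?(lie_brxx lieW) //; auto.
  - move=> x y z Ax Ay Az; apply: finj => //; first by auto 7.
    rewrite f0 !(fD, fbr); auto.
    by rewrite (lie_jacobi lieW); auto.
exists f; split=> //; split.
- by move=> x; apply: fmem.
- by move=> x y /set_mem Ax /set_mem Ay; apply: finj.
- by move=> y [c _ <-]; exists (lincomb BV c); [exact: linspan_lincomb|exact: fE].
Qed.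

End Transfer.

(** * Replacing two frame vectors by multiples of their difference and sum *)

Section BasisChange.
Variables (R : numFieldType) (V : lmodType R) (n : nat).
Variables (B B' : n.-tuple V) (i0 i1 : 'I_n) (a b : R).
Hypotheses (i01 : i0 != i1) (a0 : a != 0) (b0 : b != 0).
Hypothesis Bi0 : tnth B i0 = a *: (tnth B' i0 - tnth B' i1).
Hypothesis Bi1 : tnth B i1 = b *: (tnth B' i0 + tnth B' i1).
Hypothesis Boff : forall i, i != i0 -> i != i1 -> tnth B i = tnth B' i.

Let T (c : 'I_n -> R) i :=
  if i == i0 then a * c i0 + b * c i1
  else if i == i1 then b * c i1 - a * c i0 else c i.

(** This detaches the factors 1/4 and sqrt(3)/12 from the frame, so that the computations with [h]
    and [H] themselves stay rational. *)
Lemma lincomb_rotate c : lincomb B c = lincomb B' (T c).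
Proof.
have i10 : i1 != i0 by rewrite eq_sym.
rewrite /lincomb (bigD1 i0) // (bigD1 i1) //= Bi0 Bi1.
rewrite [RHS](bigD1 i0) // [X in _ = _ + X](bigD1 i1) //=.
rewrite /T eqxx (negbTE i10) eqxx.
under [in RHS]eq_bigr => i /andP[n0 n1].
  rewrite (negbTE n0) (negbTE n1) -Boff //; over.
rewrite !addrA; congr (_ + _).
rewrite !scalerA !(scalerDl, scalerDr, scalerBl, scalerN) ![c _ * _]mulrC.
by rewrite scaleNr !addrA [X in X + _ = _]addrAC [LHS]addrAC.
Qed.

Lemma linspan_rotate : linspan B = linspan B'.
Proof.
apply/seteqP; split=> v [c _ <-].
  by rewrite lincomb_rotate; apply: linspan_lincomb.
(* [d] solves [T d = c]: half the difference and half the sum of the two coordinates of [c] are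
   [a * d i0] and [b * d i1]. *)
pose d i := if i == i0 then (2 * a)^-1 * (c i0 - c i1)
            else if i == i1 then (2 * b)^-1 * (c i0 + c i1) else c i.
exists d => //; rewrite lincomb_rotate; congr lincomb; apply/funext => i.
have two0 : (2 : R) != 0 by rewrite pnatr_eq0.
have halfE (x k : R) : k != 0 -> k * ((2 * k)^-1 * x) = x / 2.
  by move=> k0; rewrite mulrA invfM mulrCA divff // mulr1 mulrC.
have i10 : i1 != i0 by rewrite eq_sym.
rewrite /T /d !eqxx (negbTE i10) !halfE //.
case: eqP => [->|_]; last case: eqP => [->|//]; by field.
Qed.

Lemma lin_indep_rotate : lin_indep B' -> lin_indep B.
Proof.
move=> indep c; rewrite lincomb_rotate => /indep T0.
have i10 : i1 != i0 by rewrite eq_sym.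
have := T0 i0; have := T0 i1; rewrite /T eqxx (negbTE i10) eqxx.
(* The two equations say that [b * c i1] equals [a * c i0] and that their sum is 0, so twice
   [a * c i0] vanishes. *)
move=> /eqP; rewrite subr_eq0 => /eqP-> /eqP; rewrite -mulr2n mulrn_eq0 /=.
rewrite mulf_eq0 (negbTE a0) /= => /eqP c0.
have := T0 i0; rewrite /T eqxx c0 mulr0 add0r => /eqP.
rewrite mulf_eq0 (negbTE b0) /= => /eqP c1 i.
have := T0 i; rewrite /T; case: eqP => [->//|_]; case: eqP => [->//|_]; exact.
Qed.

End BasisChange.

(** * Symbolic vector fields *)

(* [(a, b, i, j, k, l)] stands for
   exp(a theta/2 + b x/6) phi^i q^j cos(psi/2)^k sin(psi/2)^l.  The exponent of
   the sine is at most 1: higher powers are eliminated by sin^2 = 1 - cos^2, and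
   then distinct monomials are linearly independent. *)
Definition emono : Type := (int * int * nat * nat * nat * bool)%type.
Definition epoly : Type := seq (Q * emono).

(** Equal monomials are merged and zero coefficients dropped, so that a sum that cancels becomes the
    empty list; the zero test in [edecomp] rests on this. *)
Fixpoint eaddt (c : Q) (m : emono) (p : epoly) : epoly :=
  match p with
  | [::] => if Qeq_bool c Q0 then [::] else [:: (c, m)]
  | (d, n) :: p' =>
    if m == n then
      let e := Qred (Qplus c d) in
      if Qeq_bool e Q0 then p' else (e, n) :: p'
    else (d, n) :: eaddt c m p'
  end.

Definition eadd (p q : epoly) : epoly :=
  foldr (fun t r => eaddt t.1 t.2 r) q p.

Definition epsum (s : seq epoly) : epoly := foldr eadd [::] s.

Definition escale (c : Q) (p : epoly) : epoly :=
  [seq (Qred (Qmult c t.1), t.2) | t <- p].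

Definition emult (s t : Q * emono) : epoly :=
  let: (c, (a, b, i, j, k, l)) := s in
  let: (c', (a', b', i', j', k', l')) := t in
  let d := Qred (Qmult c c') in
  let m k l := (a + a', b + b', (i + i')%N, (j + j')%N, k, l) : emono in
  if l && l' then
    [:: (d, m (k + k')%N false); (Qopp d, m (k + k').+2%N false)]
  else [:: (d, m (k + k')%N (l || l'))].

Definition emul (p q : epoly) : epoly :=
  epsum [seq emult s t | s <- p, t <- q].

(** With a sine present, the term - k/2 cos^(k-1) sin^2 is rewritten by sin^2 = 1 - cos^2, which
    raises the coefficient of cos^(k+1) from 1/2 to (k+1)/2. A truncated predecessor of exponent 0
    comes with coefficient 0. *)
Definition epdt (v : nat) (s : Q * emono) : epoly :=
  let: (c, (a, b, i, j, k, l)) := s in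
  match v with
  | 0 => [:: (Qmult c (Qmake (ssrZ.Z_of_int a) 2), (a, b, i, j, k, l))]
  | 1 => [:: (Qmult c (Qmake (BinInt.Z.of_nat i) 1), (a, b, i.-1, j, k, l))]
  | 2 => [:: (Qmult c (Qmake (ssrZ.Z_of_int b) 6), (a, b, i, j, k, l))]
  | 3 => [:: (Qmult c (Qmake (BinInt.Z.of_nat j) 1), (a, b, i, j.-1, k, l))]
  | _ => if l then
      [:: (Qopp (Qmult c (Qmake (BinInt.Z.of_nat k) 2)), (a, b, i, j, k.-1, false));
          (Qmult c (Qmake (BinInt.Z.of_nat k.+1) 2), (a, b, i, j, k.+1, false))]
    else [:: (Qopp (Qmult c (Qmake (BinInt.Z.of_nat k) 2)), (a, b, i, j, k.-1, true))]
  end.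

Definition epd (v : nat) (p : epoly) : epoly := epsum [seq epdt v s | s <- p].

(** At the origin the exponentials and the cosine are 1 while phi, q and the sine vanish, so only
    monomials free of these three contribute. *)
Definition eat0 (p : epoly) : Q :=
  foldr (fun t r => let: (c, (a, b, i, j, k, l)) := t in
    if [&& i == 0%N, j == 0%N & ~~ l] then Qred (Qplus c r) else r) (Qmake 0 1) p.

Definition efield : Type := seq epoly.

Definition ecoord (X : efield) (i : nat) : epoly := nth [::] X i.

Definition ebracket (X Y : efield) : efield :=
  mkseq (fun i => epsum
    (mkseq (fun j => eadd (emul (ecoord X j) (epd j (ecoord Y i)))
      (escale (Qmake (-1) 1) (emul (ecoord Y j) (epd j (ecoord X i))))) 5)) 5.

Definition eunit (j : nat) : efield :=
  mkseq (fun i => if i == j then [:: (Qmake 1 1, (0, 0, 0%N, 0%N, 0%N, false))] else [::]) 5.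

Definition efadd (X Y : efield) : efield :=
  mkseq (fun i => eadd (ecoord X i) (ecoord Y i)) 5.
Definition efscale (f : epoly) (X : efield) : efield :=
  mkseq (fun i => emul f (ecoord X i)) 5.
Definition efopp (X : efield) : efield :=
  mkseq (fun i => escale (Qmake (-1) 1) (ecoord X i)) 5.

(** * Interpretation of symbolic expressions as functions on R^5 *)

Section Evaluation.
Variable R : realType.
Local Notation pt := 'rV[R]_5.
Local Notation rq := (@R_of_Q R).

Definition meval (m : emono) (p : pt) : R :=
  let: (a, b, i, j, k, l) := m in
  expR (a%:~R * (c_theta p / 2) + b%:~R * (c_x p / 6)) * c_phi p ^+ i
  * c_q p ^+ j * cos (c_psi p / 2) ^+ k * sin (c_psi p / 2) ^+ (l : nat).

Definition eeval (f : epoly) (p : pt) : R := \sum_(t <- f) rq t.1 * meval t.2 p.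

Lemma R_of_Q_Qeq x y : QArith_base.Qeq x y -> rq x = rq y.
Proof. by move=> /QArith_base.Qeq_bool_iff; rewrite (R_of_Q_eq R) => /eqP. Qed.

Lemma R_of_Q_red x : rq (Qred x) = rq x.
Proof. exact/R_of_Q_Qeq/Qreduction.Qred_correct. Qed.

Lemma R_of_Q_Z z d : rq (Qmake z d) = (ssrZ.int_of_Z z)%:~R / (BinPos.Pos.to_nat d)%:R.
Proof. by []. Qed.

Lemma R_of_Q_int a d : rq (Qmake (ssrZ.Z_of_int a) d) = a%:~R / (BinPos.Pos.to_nat d)%:R.
Proof. by rewrite R_of_Q_Z ssrZ.Z_of_intK. Qed.

Lemma R_of_Q_nat k d : rq (Qmake (BinInt.Z.of_nat k) d) = k%:R / (BinPos.Pos.to_nat d)%:R.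
Proof.
rewrite R_of_Q_Z (_ : ssrZ.int_of_Z _ = k) //; lia.
Qed.

Lemma Qeq_bool0 c : Qeq_bool c Q0 -> rq c = 0.
Proof. by rewrite (R_of_Q_eq R) R_of_Q0 => /eqP. Qed.

Lemma eeval0 p : eeval [::] p = 0.
Proof. by rewrite /eeval big_nil. Qed.

Lemma eeval_cons t f p : eeval (t :: f) p = rq t.1 * meval t.2 p + eeval f p.
Proof. by rewrite /eeval big_cons. Qed.

Lemma eeval_addt c m f p : eeval (eaddt c m f) p = rq c * meval m p + eeval f p.
Proof.
elim: f => [|[d n] f IH] /=.
  case: ifP => [/Qeq_bool0 ->|_]; last by rewrite eeval_cons.
  by rewrite mul0r add0r.
case: eqP => [->|_]; last by rewrite !eeval_cons IH addrCA.
have E : rq (Qred (Qplus c d)) = rq c + rq d by rewrite R_of_Q_red R_of_Q_add.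
rewrite eeval_cons /= addrA -mulrDl -E.
by case: ifP => [/Qeq_bool0 ->|_]; rewrite ?eeval_cons // mul0r add0r.
Qed.

Lemma eeval_add f g p : eeval (eadd f g) p = eeval f p + eeval g p.
Proof.
elim: f => [|t f IH] /=; first by rewrite eeval0 add0r.
by rewrite eeval_addt IH eeval_cons addrA.
Qed.

Lemma eeval_psum s p : eeval (epsum s) p = \sum_(f <- s) eeval f p.
Proof.
elim: s => [|f s IH] /=; first by rewrite big_nil eeval0.
by rewrite eeval_add IH big_cons.
Qed.

Lemma eeval_scale c f p : eeval (escale c f) p = rq c * eeval f p.
Proof.
rewrite /eeval big_map big_distrr /=; apply: eq_bigr => t _.
by rewrite R_of_Q_red R_of_Q_mul mulrA.
Qed.

Lemma eeval_mult s t p :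
  eeval (emult s t) p = (rq s.1 * meval s.2 p) * (rq t.1 * meval t.2 p).
Proof.
case: s => c [[[[[a b] i] j] k] l]; case: t => c' [[[[[a' b'] i'] j'] k'] l'] /=.
set E := expR (a%:~R * _ + _); set E' := expR (a'%:~R * _ + _).
have EE : expR ((a + a')%:~R * (c_theta p / 2) + (b + b')%:~R * (c_x p / 6)) = E * E'.
  by rewrite -expRD; congr expR; rewrite !intrD; ring.
case: l => /=; last first.
  by rewrite eeval_cons eeval0 /= EE R_of_Q_red R_of_Q_mul !exprD; ring.
case: l' => /=; rewrite !eeval_cons eeval0 /= ?EE ?R_of_Q_opp !R_of_Q_red !R_of_Q_mul.
  rewrite -(addn2 (k + k')) !exprD.
  (* Both factors contain a sine here; the symbolic product has already eliminated the square, so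
     the real identity is needed to match it. *)
  have := cos2Dsin2 (c_psi p / 2); set s := sin _; set c0 := cos _ => cs.
  have e2 : s * s = 1 - c0 ^+ 2 by rewrite -cs [X in X - _]addrC addrK expr2.
  transitivity (rq c * rq c' * E * E' * (c_phi p ^+ i * c_phi p ^+ i')
    * (c_q p ^+ j * c_q p ^+ j') * (c0 ^+ k * c0 ^+ k') * (s * s)); last by ring.
  by rewrite e2; ring.
by rewrite !exprD; ring.
Qed.

Lemma eeval_mul f g p : eeval (emul f g) p = eeval f p * eeval g p.
Proof.
rewrite eeval_psum big_allpairs_dep [X in _ = X * _]/eeval big_distrl.
apply: eq_bigr => s _.
rewrite [X in _ = _ * X]/eeval big_distrr; apply: eq_bigr => t _.
exact: eeval_mult.
Qed.

End Evaluation.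

(** * Differentiability together with the value of a directional derivative *)

Section Partials.
Variable R : realType.
Local Notation pt := 'rV[R]_5.

(** Differentiability travels with the value because the product and chain rules require it at each
    stage, and smoothness asks for it in the end. *)
Definition has_dir (p v : pt) (f : pt -> R) (d : R) : Prop :=
  differentiable f p /\ 'D_v f p = d.

Variables p v : pt.

Lemma has_dir_cst c : has_dir p v (fun=> c) 0.
Proof. by split; [exact: differentiable_cst|exact: derive_cst]. Qed.

Lemma has_dir_coord i : has_dir p v (fun w => w 0 i) (v 0 i).
Proof.
(* The coordinate is packaged as a linear map, so that it is its own differential. *)
have @f : {linear pt -> R}.
  by exists (fun w : pt => w 0 i); do 2![eexists]; do ?[constructor];
     rewrite ?mxE// => ? *; rewrite ?mxE//; move=> ?; rewrite !mxE.
rewrite (_ : (fun _ => _) = f) //.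
have cf : continuous f by exact: coord_continuous.
split; first exact: linear_differentiable.
by rewrite deriveE ?diff_lin //; exact: linear_differentiable.
Qed.

Lemma has_dirD f g a b :
  has_dir p v f a -> has_dir p v g b -> has_dir p v (fun w => f w + g w) (a + b).
Proof.
move=> [df <-] [dg <-]; split; first exact: differentiableD.
by rewrite -deriveD //; exact: diff_derivable.
Qed.

Lemma has_dirM f g a b : has_dir p v f a -> has_dir p v g b ->
  has_dir p v (fun w => f w * g w) (f p * b + g p * a).
Proof.
move=> [df <-] [dg <-]; split; first exact: differentiableM.
by rewrite [LHS]deriveM //; exact: diff_derivable.
Qed.

Lemma has_dir_comp f a (h : R -> R) b : has_dir p v f a ->
  is_derive (f p) 1 h b -> has_dir p v (fun w => h (f w)) (a * b).
Proof.
move=> [df <-] [dh <-].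
have dh' : differentiable h (f p) by exact/derivable1_diffP.
split; first exact: differentiable_comp.
rewrite deriveE; last exact: differentiable_comp.
rewrite (_ : (fun w => h (f w)) = h \o f) // diff_comp //=.
rewrite -(deriveE v df) (@deriveE _ _ _ h (f p) 1 dh').
by rewrite -[X in 'd h _ X = _]mulr1 [LHS]linearZ.
Qed.

Lemma has_dirX f a n : has_dir p v f a ->
  has_dir p v (fun w => f w ^+ n) (a * (n%:R * f p ^+ n.-1)).
Proof.
move=> fa; apply: (has_dir_comp (h := fun x => x ^+ n)) => //.
have dx : derivable (fun x : R => x ^+ n) (f p) 1 by exact: exprn_derivable.
by apply: DeriveDef => //; rewrite exp_derive -[_ *: _]/(_ * _) mulr1.
Qed.

Lemma has_dirZ c f a : has_dir p v f a -> has_dir p v (fun w => c * f w) (c * a).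
Proof.
by move=> fa; have := has_dirM (has_dir_cst c) fa; rewrite mulr0 addr0.
Qed.

Lemma has_dir_div c f a : has_dir p v f a -> has_dir p v (fun w => f w / c) (a / c).
Proof.
move=> fa; rewrite mulrC (_ : (fun w => f w / c) = fun w => c^-1 * f w).
  exact: has_dirZ.
by apply/funext => w; rewrite mulrC.
Qed.

End Partials.

(** * Partial derivatives, brackets and the given fields in symbolic form *)

Section Fields.
Variable R : realType.
Local Notation pt := 'rV[R]_5.
Local Notation rq := (@R_of_Q R).

Lemma has_dir_epdt (p : pt) (v : nat) t : (v < 5)%N ->
  has_dir p (delta_mx 0 (inord v)) (fun w => rq t.1 * meval t.2 w)
    (eeval (epdt v t) p).
Proof.
case: t => c [[[[[a b] i] j] k] l] v5.
have dE (u : nat) : (u < 5)%N ->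
    (delta_mx 0 (inord v) : pt) 0 (inord u) = (u == v)%:R.
  by move=> u5; rewrite mxE eqxx -val_eqE /= !inordK // eq_sym.
have hcoord (u : nat) : (u < 5)%N ->
    has_dir p (delta_mx 0 (inord v)) (fun w : pt => w 0 (inord u)) (u == v)%:R.
  by move=> u5; rewrite -dE //; apply: has_dir_coord.
have hE := has_dir_comp (has_dirD
  (has_dirZ a%:~R (has_dir_div 2 (hcoord 0%N isT)))
  (has_dirZ b%:~R (has_dir_div 6 (hcoord 2%N isT)))) (is_derive_expR _).
have hi := has_dirX i (hcoord 1%N isT).
have hj := has_dirX j (hcoord 3%N isT).
have hp := has_dir_div 2 (hcoord 4%N isT).
have hk := has_dirX k (has_dir_comp hp (is_derive_cos _)).
have hl := has_dirX l (has_dir_comp hp (is_derive_sin _)).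
have := has_dirZ (rq c) (has_dirM (has_dirM (has_dirM (has_dirM hE hi) hj) hk) hl).
congr has_dir => {hE hi hj hp hk hl hcoord dE}.
rewrite -/(c_theta p) -/(c_x p) -/(c_phi p) -/(c_q p) -/(c_psi p).
case: v v5 => [|[|[|[|[|//]]]]] _ /=.
- rewrite eeval_cons eeval0 /= R_of_Q_mul R_of_Q_int.
  by rewrite (_ : (BinPos.Pos.to_nat 2)%:R = 2 :> R) //; ring.
- rewrite eeval_cons eeval0 /= R_of_Q_mul R_of_Q_nat.
  by rewrite (_ : (BinPos.Pos.to_nat 1)%:R = 1 :> R) // divr1; ring.
- rewrite eeval_cons eeval0 /= R_of_Q_mul R_of_Q_int.
  by rewrite (_ : (BinPos.Pos.to_nat 6)%:R = 6 :> R) //; ring.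
- rewrite eeval_cons eeval0 /= R_of_Q_mul R_of_Q_nat.
  by rewrite (_ : (BinPos.Pos.to_nat 1)%:R = 1 :> R) // divr1; ring.
have cs := cos2Dsin2 (c_psi p / 2).
case: l => /=; rewrite !eeval_cons eeval0 /= ?R_of_Q_opp !R_of_Q_mul !R_of_Q_nat;
  rewrite (_ : (BinPos.Pos.to_nat 2)%:R = 2 :> R) //; last by ring.
move: cs; set s := sin _; set c0 := cos _ => cs.
have e2 : s * s = 1 - c0 ^+ 2 by rewrite -cs [X in X - _]addrC addrK expr2.
set E := expR _.
(* The product rule leaves a factor sin^2, isolated here so that [e2] applies; the case [k = 0] is
   then separate because [k.-1] is truncated. *)
transitivity (rq c * E * c_phi p ^+ i * c_q p ^+ j *
   (c0 ^+ k.+1 / 2 - k%:R * c0 ^+ k.-1 * (s * s) / 2)).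
  by rewrite (exprS c0 k); ring.
rewrite e2; case: k => [|k]; first by rewrite !expr1; ring.
by rewrite -(natr1 k.+1) !exprS; ring.
Qed.

Lemma has_dir_epd (p : pt) (v : nat) f : (v < 5)%N ->
  has_dir p (delta_mx 0 (inord v)) (eeval f) (eeval (epd v f) p).
Proof.
move=> v5; elim: f => [|t f IH] /=.
  rewrite eeval0 (_ : eeval [::] = fun=> 0); first exact: has_dir_cst.
  by apply/funext => w; rewrite eeval0.
rewrite (_ : eeval (t :: f) = fun w => rq t.1 * meval t.2 w + eeval f w).
  by rewrite eeval_add; apply: has_dirD => //; exact: has_dir_epdt.
by apply/funext => w; rewrite eeval_cons.
Qed.

Lemma partial_eeval (i : 'I_5) f : partial i (eeval f) = eeval (epd i f) :> (pt -> R).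
Proof.
apply/funext => p; have [_] := has_dir_epd p f (ltn_ord i).
by rewrite inord_val.
Qed.

Lemma foldr_partial_eeval (s : seq 'I_5) f :
  foldr (@partial R 5) (eeval f) s = eeval (foldr epd f (map val s)).
Proof. by elim: s => //= i s ->; rewrite partial_eeval. Qed.

Lemma differentiable_eeval f (p : pt) : differentiable (eeval f) p.
Proof. by have [] := has_dir_epd p f (ltn0Sn 4). Qed.

(** Iterated partial derivatives of an expression are expressions again, and each of these is
    differentiable. *)
Lemma smooth_eeval f : smooth_fun (@eeval R f).
Proof. by move=> s p; rewrite foldr_partial_eeval; exact: differentiable_eeval. Qed.

Definition feval (X : efield) : pt -> pt :=
  fun p => \row_(i < 5) eeval (ecoord X i) p.

Lemma coord_feval X i : Defs.coord (feval X) i = eeval (ecoord X i).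
Proof. by apply/funext => p; rewrite /Defs.coord mxE. Qed.

Lemma smooth_feval X : smooth_vfield (feval X).
Proof. by move=> i; rewrite coord_feval; exact: smooth_eeval. Qed.

Lemma ecoord_mkseq f (i : 'I_5) : ecoord (mkseq f 5) i = f i.
Proof. by rewrite /ecoord nth_mkseq. Qed.

Lemma feval_ext (F : pt -> pt) X :
  (forall i p, F p 0 i = eeval (ecoord X i) p) -> F = feval X.
Proof. by move=> H; apply/funext => p; apply/rowP => i; rewrite mxE H. Qed.

Lemma vbracket_feval X Y : vbracket (feval X) (feval Y) = feval (ebracket X Y).
Proof.
apply: feval_ext => i p; rewrite mxE ecoord_mkseq eeval_psum big_map.
rewrite -[iota 0 5]/(index_iota 0 5) big_mkord.
apply: eq_bigr => j _.
rewrite !coord_feval !partial_eeval eeval_add eeval_scale !eeval_mul.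
by rewrite R_of_Q_Z /= divr1 mulN1r.
Qed.

Lemma feval_add X Y : feval X + feval Y = feval (efadd X Y).
Proof. by apply: feval_ext => i p; rewrite !mxE ecoord_mkseq eeval_add. Qed.

Lemma feval_opp X : - feval X = feval (efopp X).
Proof.
apply: feval_ext => i p; rewrite !mxE ecoord_mkseq eeval_scale R_of_Q_Z /=.
by rewrite divr1 mulN1r.
Qed.

Lemma fscale_feval f X : fscale (eeval f) (feval X) = feval (efscale f X).
Proof. by apply: feval_ext => i p; rewrite !mxE ecoord_mkseq eeval_mul. Qed.

Lemma feval_unit j : (j < 5)%N -> @d_ R j = feval (eunit j).
Proof.
move=> j5; apply: feval_ext => i p; rewrite mxE ecoord_mkseq /=.
rewrite -val_eqE /= inordK //; case: eqP => _; last by rewrite eeval0.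
rewrite eeval_cons eeval0 /= R_of_Q_Z /= !mulr0z !mul0r !addr0 expR0.
by rewrite !expr0 !mulr1 divr1.
Qed.

Definition emon (c : Q) (a b : int) (i j k : nat) (l : bool) : epoly :=
  [:: (c, (a, b, i, j, k, l))].

(** Double-angle formulas bring psi down to psi/2: cos^2 - sin^2 here, and 2 cos sin for [esin]. *)
Definition ecos : epoly :=
  eadd (emon (Qmake 1 1) 0 0 0 0 2 false)
    (emul (emon (Qmake (-1) 1) 0 0 0 0 0 true) (emon (Qmake 1 1) 0 0 0 0 0 true)).
Definition esin : epoly := emon (Qmake 2 1) 0 0 0 0 1 true.

(** The field exp(-x/3) d_q - (1/3) d_psi common to [V1] and [V2]. Exponents are counted in units of
    theta/2 and x/6, hence the [- 2]. *)
Definition eW : efield :=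
  efadd (efscale (emon (Qmake 1 1) 0 (- 2) 0 0 0 false) (eunit 3))
    (efopp (efscale (emon (Qmake 1 3) 0 0 0 0 0 false) (eunit 4))).
Definition eV1 : efield :=
  efadd (efadd (eunit 0) (efscale ecos (eunit 2))) (efscale esin eW).
Definition eV2 : efield :=
  efadd (efadd (efadd (efscale (emon (Qmake 1 1) (-2) 0 0 0 0 false) (eunit 1)) (eunit 4))
    (efopp (efscale esin (eunit 2)))) (efscale ecos eW).
Definition eX1 : efield := efadd (efscale ecos eV1) (efopp (efscale esin eV2)).
Definition eX2 : efield := efadd (efscale ecos eV2) (efscale esin eV1).
Definition eZ1 : efield :=
  efadd (efadd (efscale (emon (Qmake 3 2) 0 0 0 0 0 false) (eunit 3))
               (efopp (efscale (emon (Qmake 3 1) 0 2 0 0 0 false) (eunit 4))))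
    (efscale (emon (Qmake 3 1) 0 2 0 0 0 false)
      (efadd (efscale esin (eunit 0))
        (efscale ecos
          (efadd (efscale (emon (Qmake 1 1) (-2) 0 0 0 0 false) (eunit 1)) (eunit 4))))).
Definition eS2 : efield :=
  efadd (efscale (emon (Qmake (-3) 2) 1 1 0 0 1 false) eX1)
    (efopp (efscale (emon (Qmake 3 1) 1 1 0 0 0 true) eX2)).
Definition eS1 : efield :=
  efadd (efadd (efscale (emon (Qmake 3 4) (-1) 1 0 0 0 true) eX1)
    (efopp (efscale (emon (Qmake 3 2) (-1) 1 0 0 1 false) eX2)))
    (efscale (emon (Qmake 1 2) 0 0 1 0 0 false) eS2).
Definition eS3 : efield :=
  efadd (efadd (efscale (emon (Qmake 4 1) 0 0 0 1 0 false) eX1)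
    (efscale (emon (Qmake 6 1) 0 (-2) 0 0 0 false) eX2))
    (efopp (efscale (emon (Qmake 4 9) 0 0 0 2 0 false) eZ1)).

Lemma eeval_mon c a b i j k l (p : pt) :
  eeval (emon c a b i j k l) p = rq c * meval (a, b, i, j, k, l) p.
Proof. by rewrite eeval_cons eeval0 addr0. Qed.

Lemma fscale_cst c (X : pt -> pt) : c *: X = fscale (fun=> c) X.
Proof. by []. Qed.

Lemma R_of_Q_num z d n m : ssrZ.int_of_Z z = n -> BinPos.Pos.to_nat d = m ->
  rq (Qmake z d) = n%:~R / m%:R.
Proof. by move=> <- <-. Qed.

Lemma eeval_cos : (fun p : pt => cos (c_psi p)) = eeval ecos.
Proof.
apply/funext => p; rewrite eeval_add eeval_mul !eeval_mon /=.
rewrite (R_of_Q_num (n := 1) (m := 1)) // (R_of_Q_num (n := -1) (m := 1)) //.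
rewrite !mulr0z !mul0r !addr0 expR0 !divr1.
have {1}-> : c_psi p = c_psi p / 2 + c_psi p / 2 by field.
by rewrite cosD; ring.
Qed.

Lemma eeval_sin : (fun p : pt => sin (c_psi p)) = eeval esin.
Proof.
apply/funext => p; rewrite !eeval_mon /=.
rewrite (R_of_Q_num (n := 2) (m := 1)) //.
rewrite !mulr0z !mul0r !addr0 expR0 !divr1.
have {1}-> : c_psi p = c_psi p / 2 + c_psi p / 2 by field.
rewrite sinD; set s := sin _; set c := cos _.
by ring.
Qed.

Let mono (c a b : R) i j k (l : bool) (p : pt) :=
  c * (expR (a * (c_theta p / 2) + b * (c_x p / 6)) * c_phi p ^+ i
  * c_q p ^+ j * cos (c_psi p / 2) ^+ k * sin (c_psi p / 2) ^+ (l : nat)).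

(** [n] and [m] restate the numerator and denominator of [c] in unary form, which leaves an identity
    of real expressions that [field] can settle. *)
Lemma emon_fun (f : pt -> R) c n m a b i j k l :
  ssrZ.int_of_Z (QArith_base.Qnum c) = n -> BinPos.Pos.to_nat (QArith_base.Qden c) = m ->
  (forall p, f p = mono (n%:~R / m%:R) a%:~R b%:~R i j k l p) ->
  f = eeval (emon c a b i j k l).
Proof.
move=> <- <- H; apply/funext => p; rewrite H eeval_mon; congr (_ * _).
Qed.

Lemma exp_emon (f : pt -> R) c n m a b :
  ssrZ.int_of_Z (QArith_base.Qnum c) = n -> BinPos.Pos.to_nat (QArith_base.Qden c) = m ->
  (forall p, f p = n%:~R / m%:R * expR (a%:~R * (c_theta p / 2) + b%:~R * (c_x p / 6))) ->
  f = eeval (emon c a b 0 0 0 false).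
Proof.
move=> cn cm H; apply: (emon_fun cn cm) => p.
by rewrite H /mono !expr0 !mulr1.
Qed.

Lemma cst_emon (c : R) q n m :
  ssrZ.int_of_Z (QArith_base.Qnum q) = n -> BinPos.Pos.to_nat (QArith_base.Qden q) = m ->
  c = n%:~R / m%:R ->
  (fun=> c) = eeval (emon q 0 0 0 0 0 false) :> (pt -> R).
Proof.
move=> cn cm H; apply: (exp_emon cn cm) => p.
by rewrite H !mul0r addr0 expR0 mulr1.
Qed.

Let exp_x : (fun p : pt => expR (- (c_x p / 3))) = eeval (emon (Qmake 1 1) 0 (-2) 0 0 0 false).
Proof.
apply: (exp_emon erefl erefl) => p.
by rewrite mul0r add0r divr1 mul1r; congr expR; field.
Qed.

Let exp_theta : (fun p : pt => expR (- c_theta p)) = eeval (emon (Qmake 1 1) (-2) 0 0 0 0 false).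
Proof.
apply: (exp_emon erefl erefl) => p.
by rewrite mul0r addr0 divr1 mul1r; congr expR; field.
Qed.

Let third : (fun=> 1 / 3) = eeval (emon (Qmake 1 3) 0 0 0 0 0 false) :> (pt -> R).
Proof. exact: (cst_emon erefl erefl). Qed.

Lemma V1_feval : @V1 R = feval eV1.
Proof.
rewrite /V1 eeval_cos eeval_sin exp_x /d_theta /d_x /d_q /d_psi.
rewrite (fscale_cst (1 / 3)) third !feval_unit //.
by rewrite !(fscale_feval, feval_opp, feval_add).
Qed.

Lemma V2_feval : @V2 R = feval eV2.
Proof.
rewrite /V2 eeval_cos eeval_sin exp_x exp_theta /d_phi /d_x /d_q /d_psi.
rewrite (fscale_cst (1 / 3)) third !feval_unit //.
by rewrite !(fscale_feval, feval_opp, feval_add).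
Qed.

Lemma X1_feval : @X1 R = feval eX1.
Proof.
rewrite /X1 eeval_cos eeval_sin V1_feval V2_feval.
by rewrite !(fscale_feval, feval_opp, feval_add).
Qed.

Lemma X2_feval : @X2 R = feval eX2.
Proof.
rewrite /X2 eeval_cos eeval_sin V1_feval V2_feval.
by rewrite !(fscale_feval, feval_opp, feval_add).
Qed.

Lemma Z1_feval : @Z1 R = feval eZ1.
Proof.
rewrite /Z1 eeval_cos eeval_sin exp_theta /d_theta /d_phi /d_q /d_psi.
rewrite (fscale_cst (3 / 2)) (cst_emon (q := Qmake 3 2) erefl erefl erefl).
rewrite (_ : (fun p : pt => 3 * expR (c_x p / 3)) = eeval (emon (Qmake 3 1) 0 2 0 0 0 false)).
  by rewrite !feval_unit // !(fscale_feval, feval_opp, feval_add).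
apply: (exp_emon erefl erefl) => p.
by rewrite mul0r add0r divr1; congr (_ * expR _); field.
Qed.

Lemma S2_feval : S2 R = feval eS2.
Proof.
rewrite /S2 X1_feval X2_feval.
rewrite (emon_fun (f := fun p : pt =>
    - (3 / 2) * cos (c_psi p / 2) * expR (c_theta p / 2 + c_x p / 6))
  (c := Qmake (-3) 2) (n := -3) (m := 2) (a := 1) (b := 1) (i := 0) (j := 0)
  (k := 1) (l := false) erefl erefl); last first.
  move=> p; rewrite /mono !expr0 expr1 !mulr1z !mul1r;
    by field.
rewrite (emon_fun (f := fun p : pt =>
    3 * sin (c_psi p / 2) * expR (c_theta p / 2 + c_x p / 6))
  (c := Qmake 3 1) (n := 3) (m := 1) (a := 1) (b := 1) (i := 0) (j := 0)
  (k := 0) (l := true) erefl erefl); last first.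
  move=> p; rewrite /mono !expr0 expr1 !mulr1z !mul1r;
    by field.
by rewrite !(fscale_feval, feval_opp, feval_add).
Qed.

Lemma S1_feval : S1 R = feval eS1.
Proof.
rewrite /S1 X1_feval X2_feval S2_feval.
rewrite (emon_fun (f := fun p : pt =>
    3 / 4 * sin (c_psi p / 2) * expR (c_x p / 6 - c_theta p / 2))
  (c := Qmake 3 4) (n := 3) (m := 4) (a := -1) (b := 1) (i := 0) (j := 0)
  (k := 0) (l := true) erefl erefl); last first.
  move=> p; rewrite /mono !expr0 expr1 mulrN1z mulr1z mulN1r mul1r [- _ + _]addrC;
    by field.
rewrite (emon_fun (f := fun p : pt =>
    3 / 2 * cos (c_psi p / 2) * expR (c_x p / 6 - c_theta p / 2))
  (c := Qmake 3 2) (n := 3) (m := 2) (a := -1) (b := 1) (i := 0) (j := 0)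
  (k := 1) (l := false) erefl erefl); last first.
  move=> p; rewrite /mono !expr0 expr1 mulrN1z mulr1z mulN1r mul1r [- _ + _]addrC;
    by field.
rewrite (emon_fun (f := fun p : pt => 1 / 2 * c_phi p)
  (c := Qmake 1 2) (n := 1) (m := 2) (a := 0) (b := 0) (i := 1) (j := 0)
  (k := 0) (l := false) erefl erefl); last first.
  move=> p; rewrite /mono !expr0 expr1 !mul0r addr0 expR0;
    by field.
by rewrite !(fscale_feval, feval_opp, feval_add).
Qed.

Lemma S3_feval : S3 R = feval eS3.
Proof.
rewrite /S3 X1_feval X2_feval Z1_feval.
rewrite (emon_fun (f := fun p : pt => 4 * c_q p)
  (c := Qmake 4 1) (n := 4) (m := 1) (a := 0) (b := 0) (i := 0) (j := 1)
  (k := 0) (l := false) erefl erefl); last first.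
  move=> p; rewrite /mono !expr0 expr1 !mul0r addr0 expR0;
    by field.
rewrite (emon_fun (f := fun p : pt => 4 / 9 * c_q p ^+ 2)
  (c := Qmake 4 9) (n := 4) (m := 9) (a := 0) (b := 0) (i := 0) (j := 2)
  (k := 0) (l := false) erefl erefl); last first.
  move=> p; rewrite /mono !expr0 !mul0r addr0 expR0;
    by field.
rewrite (_ : (fun p : pt => 6 * expR _) = eeval (emon (Qmake 6 1) 0 (-2) 0 0 0 false)).
  by rewrite !(fscale_feval, feval_opp, feval_add).
apply: (exp_emon erefl erefl) => p.
by rewrite mul0r add0r divr1; congr (_ * expR _); field.
Qed.

End Fields.

(** * Derivations of the split octonions *)

Definition qsum (n : nat) (f : nat -> Q) : Q :=
  foldr (fun i r => Qred (Qplus (f i) r)) Q0 (iota 0 n).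

Definition qmat : Type := seq (seq Q).
Definition qentry (M : qmat) (i j : nat) : Q := nth Q0 (nth [::] M i) j.

Definition qcomm (M N : qmat) : qmat :=
  mkseq (fun i => mkseq (fun j => Qred (Qplus
    (qsum 8 (fun k => Qmult (qentry M i k) (qentry N k j)))
    (Qopp (qsum 8 (fun k => Qmult (qentry N i k) (qentry M k j)))))) 8) 8.

(** * Split octonions in eight coordinates *)

Section Zorn.
Variable R : realType.
Local Notation zorn := (R^o * 'rV[R]_3 * 'rV[R]_3 * R^o)%type.
Local Notation rq := (@R_of_Q R).

Lemma R_of_Q_qsum n f : rq (qsum n f) = \sum_(i < n) rq (f i).
Proof.
rewrite -(big_mkord xpredT (fun i => rq (f i))) /qsum /index_iota subn0.
elim: (iota 0 n) => [|i s IH] /=; first by rewrite big_nil R_of_Q0.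
by rewrite R_of_Q_red R_of_Q_add IH big_cons.
Qed.

(* Coordinates on the split octonions: 0 and 7 are the scalars, 1-3 and 4-6
   the two vectors. *)
Definition zcoord (x : zorn) (n : nat) : R :=
  let: (a, u, v, b) := x in
  if n == 0%N then a else if n == 7%N then b
  else if (n < 4)%N then u 0 (inord n.-1) else v 0 (inord (n - 4)).

Definition zmake (f : nat -> R) : zorn :=
  (f 0%N, \row_(i < 3) f i.+1, \row_(i < 3) f (i + 4)%N, f 7%N).

Lemma zmakeK f i : (i < 8)%N -> zcoord (zmake f) i = f i.
Proof.
case: i => [|i] //= i7; rewrite eqSS; case: eqP => [->//|i6].
case: ifP => [i4|i4].
  by rewrite mxE inordK.
rewrite mxE inordK ?subnK //; lia.
Qed.

Lemma zcoordK x : zmake (zcoord x) = x.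
Proof.
case: x => [[[a u] v] b]; rewrite /zmake /=; congr (_, _, _, _).
  apply/rowP => i; rewrite mxE /= eqSS ltnS ltn_ord inord_val.
  by case: eqP => // i6; have := ltn_ord i; rewrite i6.
apply/rowP => i; rewrite mxE !addnS addn0 /= !eqSS.
case: eqP => [i3|_]; first by have := ltn_ord i; rewrite i3.
by rewrite !subSS subn0 inord_val.
Qed.

#[local] Arguments zcoord : simpl never.

Lemma eq_zmake f g : (forall i, (i < 8)%N -> f i = g i) -> zmake f = zmake g.
Proof.
move=> fg; rewrite /zmake !fg //; congr (_, _, _, _).
  by apply/rowP => i; rewrite !mxE fg //; have := ltn_ord i; lia.
by apply/rowP => i; rewrite !mxE fg //; have := ltn_ord i; lia.
Qed.

Lemma zcoord_inj x y : (forall i, (i < 8)%N -> zcoord x i = zcoord y i) -> x = y.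
Proof. by move=> /eq_zmake; rewrite !zcoordK. Qed.

Lemma zmakeP k f g : k *: zmake f + zmake g = zmake (fun i => k * f i + g i).
Proof.
by congr (_, _, _, _); apply/rowP => i; rewrite !mxE.
Qed.

Lemma zcoordP k x y i : (i < 8)%N ->
  zcoord (k *: x + y) i = k * zcoord x i + zcoord y i.
Proof. by move=> i8; rewrite -{1}[x]zcoordK -{1}[y]zcoordK zmakeP zmakeK. Qed.

Lemma zcoordB x y i : (i < 8)%N -> zcoord (x - y) i = zcoord x i - zcoord y i.
Proof.
move=> i8; rewrite (_ : x - y = (-1 : R) *: y + x); last by rewrite scaleN1r addrC.
by rewrite zcoordP // mulN1r addrC.
Qed.

(** With dot and cross products unfolded, identities in the algebra become polynomial identities
    within reach of [ring]. *)
Definition zmulc (f g : nat -> R) (i : nat) : R :=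
  match i with
  | 0%N => f 0%N * g 0%N + (f 1%N * g 4%N + f 2%N * g 5%N + f 3%N * g 6%N)
  | 1%N => f 0%N * g 1%N + g 7%N * f 1%N - (f 5%N * g 6%N - f 6%N * g 5%N)
  | 2%N => f 0%N * g 2%N + g 7%N * f 2%N - (f 6%N * g 4%N - f 4%N * g 6%N)
  | 3%N => f 0%N * g 3%N + g 7%N * f 3%N - (f 4%N * g 5%N - f 5%N * g 4%N)
  | 4%N => g 0%N * f 4%N + f 7%N * g 4%N + (f 2%N * g 3%N - f 3%N * g 2%N)
  | 5%N => g 0%N * f 5%N + f 7%N * g 5%N + (f 3%N * g 1%N - f 1%N * g 3%N)
  | 6%N => g 0%N * f 6%N + f 7%N * g 6%N + (f 1%N * g 2%N - f 2%N * g 1%N)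
  | _ => f 7%N * g 7%N + (f 4%N * g 1%N + f 5%N * g 2%N + f 6%N * g 3%N)
  end.

Lemma zorn_mul_zmake f g : zorn_mul (zmake f) (zmake g) = zmake (zmulc f g).
Proof.
rewrite /zorn_mul /zmake /=; congr (_, _, _, _).
- by rewrite /dot3 !big_ord_recl big_ord0 !mxE /= addr0 !addrA.
- by apply/rowP => -[[|[|[|//]]] i3]; rewrite !mxE.
- by apply/rowP => -[[|[|[|//]]] i3]; rewrite !mxE.
- by rewrite /dot3 !big_ord_recl big_ord0 !mxE /= addr0 !addrA.
Qed.

Definition act (M : qmat) (x : zorn) : zorn :=
  zmake (fun i => \sum_(j < 8) rq (qentry M i j) * zcoord x j).

Lemma act_linear M : linear (act M).
Proof.
move=> k x y; rewrite /act zmakeP; apply: eq_zmake => i _.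
rewrite mulr_sumr -big_split /=; apply: eq_bigr => j _.
by rewrite zcoordP // mulrDr mulrCA.
Qed.

(** Brackets of the chosen derivations thus reduce to computations with rational 8 by 8 matrices. *)
Lemma commutator_act M N : commutator (act M) (act N) = act (qcomm M N).
Proof.
apply/funext => x; apply: zcoord_inj => i i8.
rewrite /commutator zcoordB // !zmakeK //.
under [X in _ - X]eq_bigr => j _ do rewrite zmakeK // mulr_sumr.
under [X in X - _]eq_bigr => j _ do rewrite zmakeK // mulr_sumr.
rewrite exchange_big [X in _ - X]exchange_big -sumrB /=.
apply: eq_bigr => k _.
rewrite /qcomm /qentry !nth_mkseq // R_of_Q_red R_of_Q_add R_of_Q_opp !R_of_Q_qsum.
rewrite mulrDl mulNr !mulr_suml; congr (_ - _);
  by apply: eq_bigr => j _; rewrite R_of_Q_mul mulrA.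
Qed.

Definition zbase (j : nat) : zorn := zmake (fun i => (i == j)%:R).

Lemma zcoord_act M i j : (i < 8)%N -> (j < 8)%N ->
  zcoord (act M (zbase j)) i = rq (qentry M i j).
Proof.
move=> i8 j8; rewrite zmakeK // (bigD1 (Ordinal j8)) //= zmakeK // eqxx mulr1.
rewrite big1 ?addr0 // => k /negbTE kj; rewrite zmakeK //.
by rewrite -val_eqE /= in kj; rewrite kj mulr0.
Qed.

End Zorn.

(* The derivation (a, u, v, b) |-> (e.v, (b - a) e, - e x u, - e.v), where e
   is the k-th unit vector. *)
Definition gmat (k : nat) : qmat :=
  mkseq (fun i => mkseq (fun j => Qmake (
    if (i, j) \in [:: (0, k + 4); (k + 1, 7); ((k + 1) %% 3 + 4, (k + 2) %% 3 + 1)]%N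
    then 1
    else if (i, j) \in [:: (7, k + 4); (k + 1, 0); ((k + 2) %% 3 + 4, (k + 1) %% 3 + 1)]%N
    then -1 else 0) 1) 8) 8.

Section Derivations.
Variable R : realType.
Local Notation zorn := (R^o * 'rV[R]_3 * 'rV[R]_3 * R^o)%type.
Local Notation rq := (@R_of_Q R).
#[local] Arguments zcoord : simpl never.

Let gc (k : nat) (f : nat -> R) (i : nat) : R :=
  if i == 0%N then f (k + 4)%N else if i == 7%N then - f (k + 4)%N
  else if i == k.+1 then f 7%N - f 0%N
  else if i == ((k + 2) %% 3 + 4)%N then - f ((k + 1) %% 3 + 1)%N
  else if i == ((k + 1) %% 3 + 4)%N then f ((k + 2) %% 3 + 1)%N
  else 0.

Lemma act_gmat k f : (k < 3)%N -> act (gmat k) (zmake f) = zmake (gc k f).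
Proof.
have q1 : rq (Qmake 1 1) = 1 by exact: R_of_Q1.
have q0 : rq (Qmake 0 1) = 0 by exact: R_of_Q0.
have qN : rq (Qmake (-1) 1) = -1 by rewrite (R_of_Q_opp _ (Qmake 1 1)) q1.
move=> k3; apply: eq_zmake => i i8.
under eq_bigr => j _ do rewrite zmakeK // /qentry !nth_mkseq //.
rewrite !big_ord_recl big_ord0 /=.
case: k k3 => [|[|[|//]]] _;
  case: i i8 => [|[|[|[|[|[|[|[|//]]]]]]]] _;
  rewrite /gc /= ?q1 ?q0 ?qN; ring.
Qed.

(** For each [k] and each of the eight components the Leibniz rule is a polynomial identity in the
    coordinates of both arguments. *)
Lemma act_gmat_derivation k : (k < 3)%N -> split_g2 (act (R := R) (gmat k)).
Proof.
move=> k3; split; first exact: act_linear.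
move=> x y; rewrite -(zcoordK x) -(zcoordK y).
rewrite !(zorn_mul_zmake, act_gmat) //.
apply: zcoord_inj => i i8; rewrite -[X in X + _]scale1r zcoordP // !zmakeK // mul1r.
set f := zcoord x; set g := zcoord y; clearbody f g.
case: k k3 => [|[|[|//]]] _;
  case: i i8 => [|[|[|[|[|[|[|[|//]]]]]]]] _;
  rewrite /gc /zmulc /=; ring.
Qed.

Lemma zorn_mulPl k (x y z : zorn) :
  zorn_mul (k *: x + y) z = k *: zorn_mul x z + zorn_mul y z.
Proof.
rewrite -(zcoordK x) -(zcoordK y) -(zcoordK z) zmakeP !zorn_mul_zmake zmakeP.
apply: eq_zmake => -[|[|[|[|[|[|[|[|//]]]]]]]] _; rewrite /zmulc; ring.
Qed.

Lemma zorn_mulPr k (x y z : zorn) :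
  zorn_mul z (k *: x + y) = k *: zorn_mul z x + zorn_mul z y.
Proof.
rewrite -(zcoordK x) -(zcoordK y) -(zcoordK z) zmakeP !zorn_mul_zmake zmakeP.
apply: eq_zmake => -[|[|[|[|[|[|[|[|//]]]]]]]] _; rewrite /zmulc; ring.
Qed.

End Derivations.

(** * The Lie algebra of derivations of a bilinear product *)

Section DerivationAlgebra.
Variables (R : comNzRingType) (V : lmodType R) (mul : V -> V -> V).
Hypothesis mulPl : forall k x y z, mul (k *: x + y) z = k *: mul x z + mul y z.
Hypothesis mulPr : forall k x y z, mul z (k *: x + y) = k *: mul z x + mul z y.

Let linB (D : V -> V) : linear D -> forall x y, D (x - y) = D x - D y.
Proof.
move=> lD x y; have := lD (-1) y x.
by rewrite !scaleN1r => e; rewrite [x - y]addrC e addrC.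
Qed.

Let mulBl x y z : mul (x - y) z = mul x z - mul y z.
Proof. by apply: (linB (D := fun x => mul x z)) => k a b; exact: mulPl. Qed.
Let mulBr x y z : mul z (x - y) = mul z x - mul z y.
Proof. by apply: (linB (D := mul z)) => k a b; exact: mulPr. Qed.

Lemma lie_algebra_derivations :
  lie_algebra (@commutator R V) [set D | is_derivation mul D].
Proof.
have mul0l z : mul 0 z = 0 by have := mulBl 0 0 z; rewrite !subrr.
have mul0r z : mul z 0 = 0 by have := mulBr 0 0 z; rewrite !subrr.
split.
- split; first by move=> k x y; rewrite scaler0 addr0.
  by move=> x y; rewrite mul0l mul0r addr0.
- move=> k D E [lD dD] [lE dE]; split.
    move=> c x y /=; rewrite [LHS](_ : _ = k *: D (c *: x + y) + E (c *: x + y)) //.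
    rewrite lD lE [in RHS](_ : (k *: D + E) x = k *: D x + E x) //.
    rewrite (_ : (k *: D + E) y = k *: D y + E y) //.
    by rewrite !scalerDr !scalerA mulrC addrACA.
  move=> x y; rewrite [LHS](_ : _ = k *: D (mul x y) + E (mul x y)) //.
  rewrite (_ : (k *: D + E) x = k *: D x + E x) //.
  rewrite (_ : (k *: D + E) y = k *: D y + E y) //.
  by rewrite mulPl mulPr dD dE scalerDr addrACA.
- move=> D E [lD dD] [lE dE]; split.
    move=> c x y; rewrite /commutator lE lD lD lE scalerBr.
    by rewrite opprD addrACA.
  move=> x y; rewrite /commutator dE dD.
  have lD1 a b : D (a + b) = D a + D b by rewrite -[a]scale1r lD !scale1r.
  have lE1 a b : E (a + b) = E a + E b by rewrite -[a]scale1r lE !scale1r.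
  rewrite lD1 lE1 !dE !dD mulBl mulBr !opprD !addrA.
  set a := mul (D (E x)) y; set b := mul (E x) (D y); set c := mul (D x) (E y).
  set d := mul x (D (E y)); set e := mul (E (D x)) y; set f := mul x (E (D y)).
  (* The mixed products [b] and [c] occur once with each sign and cancel. *)
  by rewrite [LHS](ACl (1*5*4*8*(2*7)*(3*6))) /= !subrr !addr0.
- move=> k D E F _ _ [lF _]; apply/funext => v; rewrite /commutator.
  rewrite [LHS](_ : _ = k *: D (F v) + E (F v) - F (k *: D v + E v)) //.
  rewrite lF opprD addrACA -scalerBr //.
- move=> k D E F _ _ [lF _]; apply/funext => v; rewrite /commutator.
  rewrite [LHS](_ : _ = F (k *: D v + E v) - (k *: D (F v) + E (F v))) //.
  rewrite lF opprD addrACA -scalerBr //.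
- by move=> D _; apply/funext => v; rewrite /commutator subrr.
- move=> D E F [/linB lD _] [/linB lE _] [/linB lF _]; apply/funext => v.
  rewrite /commutator [LHS](_ : _ = D (E (F v) - F (E v)) - (E (F (D v)) - F (E (D v))) +
    (E (F (D v) - D (F v)) - (F (D (E v)) - D (F (E v)))) +
    (F (D (E v) - E (D v)) - (D (E (F v)) - E (D (F v))))) //.
  rewrite lD lE lF !opprB !addrA.
  (* The twelve triple composites cancel in six pairs. *)
  rewrite [LHS](ACl (1*12*(7*2)*(3*10)*(5*4)*(11*6)*(9*8))) /=.
  by rewrite !subrr !addr0.
Qed.

End DerivationAlgebra.

(* Matrix entries (row, column) of a derivation. *)
Definition gpivots : seq (nat * nat) :=
  [:: (1, 0); (2, 0); (3, 0); (4, 0); (5, 0); (6, 0);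
      (1, 1); (2, 1); (3, 1); (1, 2); (2, 2); (3, 2); (1, 3); (2, 3)]%N.

(** * A derivation is determined by 14 matrix entries *)

Section Rigidity.
Variable R : realType.
Local Notation zorn := (R^o * 'rV[R]_3 * 'rV[R]_3 * R^o)%type.
#[local] Arguments zcoord : simpl never.

Definition zentry (D : zorn -> zorn) (i j : nat) : R := zcoord (D (zbase R j)) i.
#[local] Arguments zentry D i%_N j%_N.

Lemma derivation_matrix D f : is_derivation (@zorn_mul R) D ->
  D (zmake f) = zmake (fun i => \sum_(j < 8) f j * zentry D i j).
Proof.
move=> [lD _].
have -> : zmake f = lincomb [tuple zbase R j | j < 8] (fun j => f j).
  apply: zcoord_inj => i i8; rewrite zmakeK //.
  transitivity (\sum_(j < 8) f j * zcoord (zbase R j) i).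
    rewrite (bigD1 (Ordinal i8)) //= zmakeK // eqxx mulr1 big1 ?addr0 // => k.
    by rewrite -val_eqE /= eq_sym zmakeK // => /negbTE ->; rewrite mulr0.
  rewrite (linear_on_lincomb (g := fun x : zorn => zcoord x i : R^o)).
    by apply: eq_bigr => j _; rewrite tnth_mktuple.
  by move=> k x y _ _; rewrite zcoordP.
rewrite linear_on_lincomb; last by move=> k x y _ _; exact: lD.
apply: zcoord_inj => i i8; rewrite zmakeK //.
transitivity (zcoord (lincomb [tuple D (zbase R j) | j < 8] (fun j => f j)) i).
  by congr zcoord; apply: eq_bigr => j _; rewrite !tnth_mktuple.
rewrite (linear_on_lincomb (g := fun x : zorn => zcoord x i : R^o)).
  by apply: eq_bigr => j _; rewrite tnth_mktuple.
by move=> k x y _ _; rewrite zcoordP.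
Qed.

Let delta (j i : nat) : R := (i == j)%:R.

(** Each pair of basis elements [j], [k] and each component [i] give one linear equation between
    matrix entries. The sum runs over an explicit list so that it unfolds into eight terms. *)
Let leibniz D j k i :
  is_derivation (@zorn_mul R) D -> (j < 8)%N -> (k < 8)%N -> (i < 8)%N ->
  \sum_(l <- iota 0 8) zmulc (delta j) (delta k) l * zentry D i l =
  zmulc (fun l => zentry D l j) (delta k) i
  + zmulc (delta j) (fun l => zentry D l k) i.
Proof.
move=> Dder j8 k8 i8; have [_ /(_ (zbase R j) (zbase R k))] := Dder.
rewrite zorn_mul_zmake derivation_matrix // => /(congr1 (fun x => zcoord x i)).
rewrite zmakeK // -(big_mkord xpredT (fun l => zmulc _ _ l * zentry D i l)) => ->.
have dE l : D (zbase R l) = zmake (fun i => zentry D i l) by rewrite -[LHS]zcoordK.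
by rewrite !dE !zorn_mul_zmake -[X in X + _]scale1r zcoordP // !zmakeK // mul1r.
Qed.

Local Notation L D j k i := (@leibniz _ j%N k%N i%N D isT isT isT).
Ltac leib := rewrite !big_cons big_nil /zmulc /delta /=; clear; lra.

(** The pivots number 6 + 8: six entries of the image of the idempotent (1, 0, 0, 0), and a 3 by 3
    block without its last diagonal entry, which the trace condition supplies. *)
Lemma derivation_eq0 D : is_derivation (@zorn_mul R) D ->
  {in gpivots, forall e, zentry D e.1 e.2 = 0} -> D = 0.
Proof.
move=> Dder pivot0.
have p i j : (i, j) \in gpivots -> zentry D i j = 0 by exact: pivot0.
(* In these names the column comes first: [d01] is the entry in row 1 and column 0. *)
have d01 := p 1%N 0%N isT.  have d02 := p 2%N 0%N isT. have d03 := p 3%N 0%N isT.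
have d04 := p 4%N 0%N isT.  have d05 := p 5%N 0%N isT. have d06 := p 6%N 0%N isT.
have d11 := p 1%N 1%N isT.  have d12 := p 2%N 1%N isT. have d13 := p 3%N 1%N isT.
have d21 := p 1%N 2%N isT.  have d22 := p 2%N 2%N isT. have d23 := p 3%N 2%N isT.
have d31 := p 1%N 3%N isT.  have d32 := p 2%N 3%N isT.
(* D kills the idempotents (1, 0, 0, 0) and (0, 0, 0, 1), so it preserves the two
   spaces of vectors.  Its blocks there are opposite transposes of each other
   because the product of u and v is a scalar, and the product of two vectors u
   makes them traceless. *)
have d00 : zentry D 0 0 = 0 by move: (L Dder 0 0 0); leib.
have d07 : zentry D 7 0 = 0 by move: (L Dder 0 0 7); leib.
have d70 : zentry D 0 7 = 0 by move: (L Dder 0 7 0); leib.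
have d71 : zentry D 1 7 = 0 by move: d01 (L Dder 0 7 1); leib.
have d72 : zentry D 2 7 = 0 by move: d02 (L Dder 0 7 2); leib.
have d73 : zentry D 3 7 = 0 by move: d03 (L Dder 0 7 3); leib.
have d74 : zentry D 4 7 = 0 by move: d04 (L Dder 7 0 4); leib.
have d75 : zentry D 5 7 = 0 by move: d05 (L Dder 7 0 5); leib.
have d76 : zentry D 6 7 = 0 by move: d06 (L Dder 7 0 6); leib.
have d77 : zentry D 7 7 = 0 by move: (L Dder 7 7 7); leib.
have d10 : zentry D 0 1 = 0 by move: d74 (L Dder 1 7 0); leib.
have d14 : zentry D 4 1 = 0 by move: (L Dder 0 1 4); leib.
have d15 : zentry D 5 1 = 0 by move: d03 (L Dder 0 1 5); leib.
have d16 : zentry D 6 1 = 0 by move: d02 (L Dder 0 1 6); leib.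
have d17 : zentry D 7 1 = 0 by move: d04 (L Dder 0 1 7); leib.
have d20 : zentry D 0 2 = 0 by move: d75 (L Dder 2 7 0); leib.
have d24 : zentry D 4 2 = 0 by move: d03 (L Dder 0 2 4); leib.
have d25 : zentry D 5 2 = 0 by move: (L Dder 0 2 5); leib.
have d26 : zentry D 6 2 = 0 by move: d01 (L Dder 0 2 6); leib.
have d27 : zentry D 7 2 = 0 by move: d05 (L Dder 0 2 7); leib.
have d30 : zentry D 0 3 = 0 by move: d76 (L Dder 3 7 0); leib.
have d34 : zentry D 4 3 = 0 by move: d02 (L Dder 0 3 4); leib.
have d35 : zentry D 5 3 = 0 by move: d01 (L Dder 0 3 5); leib.
have d36 : zentry D 6 3 = 0 by move: (L Dder 0 3 6); leib.
have d37 : zentry D 7 3 = 0 by move: d06 (L Dder 0 3 7); leib.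
have d40 : zentry D 0 4 = 0 by move: d71 (L Dder 7 4 0); leib.
have d41 : zentry D 1 4 = 0 by move: (L Dder 7 4 1); leib.
have d42 : zentry D 2 4 = 0 by move: d76 (L Dder 7 4 2); leib.
have d43 : zentry D 3 4 = 0 by move: d75 (L Dder 7 4 3); leib.
have d47 : zentry D 7 4 = 0 by move: d01 (L Dder 4 0 7); leib.
have d50 : zentry D 0 5 = 0 by move: d72 (L Dder 7 5 0); leib.
have d51 : zentry D 1 5 = 0 by move: d76 (L Dder 7 5 1); leib.
have d52 : zentry D 2 5 = 0 by move: (L Dder 7 5 2); leib.
have d53 : zentry D 3 5 = 0 by move: d74 (L Dder 7 5 3); leib.
have d57 : zentry D 7 5 = 0 by move: d02 (L Dder 5 0 7); leib.
have d60 : zentry D 0 6 = 0 by move: d73 (L Dder 7 6 0); leib.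
have d61 : zentry D 1 6 = 0 by move: d75 (L Dder 7 6 1); leib.
have d62 : zentry D 2 6 = 0 by move: d74 (L Dder 7 6 2); leib.
have d63 : zentry D 3 6 = 0 by move: (L Dder 7 6 3); leib.
have d67 : zentry D 7 6 = 0 by move: d03 (L Dder 6 0 7); leib.
have d44 : zentry D 4 4 = 0 by move: d00 d11 (L Dder 1 4 0); leib.
have d45 : zentry D 5 4 = 0 by move: d21 (L Dder 2 4 0); leib.
have d46 : zentry D 6 4 = 0 by move: d31 (L Dder 3 4 0); leib.
have d54 : zentry D 4 5 = 0 by move: d12 (L Dder 1 5 0); leib.
have d55 : zentry D 5 5 = 0 by move: d00 d22 (L Dder 2 5 0); leib.
have d56 : zentry D 6 5 = 0 by move: d32 (L Dder 3 5 0); leib.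
have d64 : zentry D 4 6 = 0 by move: d13 (L Dder 1 6 0); leib.
have d65 : zentry D 5 6 = 0 by move: d23 (L Dder 2 6 0); leib.
have d66 : zentry D 6 6 = 0 by move: d11 d22 (L Dder 1 2 6); leib.
have d33 : zentry D 3 3 = 0 by move: d00 d66 (L Dder 3 6 0); leib.
have d0 i j : (i < 8)%N -> (j < 8)%N -> zentry D i j = 0.
  move=> i8 j8; case: j j8 => [|[|[|[|[|[|[|[|//]]]]]]]] _;
    by case: i i8 => [|[|[|[|[|[|[|[|//]]]]]]]] _.
apply/funext => x; apply: zcoord_inj => i i8.
rewrite -(zcoordK x) derivation_matrix // zmakeK // big1.
  by rewrite -[X in zcoord X i](subrr (0 : zorn)) zcoordB // subrr.
by move=> j _; rewrite d0 // mulr0.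
Qed.

End Rigidity.

(** * Structure constants *)

(** The bracket is a parameter, so that one formula serves vector fields, symbolic fields,
    derivations and matrices. Positions 6 and 7 hold [h] and [H] themselves. *)
Definition frame (T : Type) (br : T -> T -> T) (s1 s2 s3 : T) : seq T :=
  let s4 := br s1 s2 in
  let s5 := br s2 s3 in
  let s6 := br s3 s1 in
  [:: s1; s2; s3; s4; s5; s6; br s4 s3; br s2 s6;
      br s1 s4; br s4 s2; br s2 s5; br s5 s3; br s3 s6; br s6 s1].

Lemma map_frame (T U : Type) (f : T -> U) br br' s1 s2 s3 :
  (forall x y, f (br x y) = br' (f x) (f y)) ->
  map f (frame br s1 s2 s3) = frame br' (f s1) (f s2) (f s3).
Proof. by move=> fbr; rewrite /frame /= !fbr. Qed.

Definition tframe (T : Type) (br : T -> T -> T) (s1 s2 s3 : T) : 14.-tuple T :=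
  @Tuple 14 T (frame br s1 s2 s3) isT.

Lemma tnth_tframe (T U : Type) x0 (f : T -> U) br br' s1 s2 s3 i :
  (forall x y, f (br x y) = br' (f x) (f y)) ->
  tnth (tframe br' (f s1) (f s2) (f s3)) i = f (nth x0 (frame br s1 s2 s3) i).
Proof.
by move=> fbr; rewrite (tnth_nth (f x0)) /= -(map_frame s1 s2 s3 fbr) (nth_map x0).
Qed.

Definition efs : seq efield := Eval vm_compute in frame ebracket eS1 eS2 eS3.
Definition gms : seq qmat := Eval vm_compute in frame qcomm (gmat 0) (gmat 1) (gmat 2).

Lemma efsE : frame ebracket eS1 eS2 eS3 = efs. Proof. by vm_compute. Qed.
Lemma gmsE : frame qcomm (gmat 0) (gmat 1) (gmat 2) = gms. Proof. by vm_compute. Qed.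

(* The rational matrix whose row k has the nonzero entries z/d, for (t, z) in
   the k-th list of s, in column t. *)
Definition qsparse (d : BinNums.positive) (s : seq (seq (nat * Z))) (k t : nat) : Q :=
  Qmake (foldr (fun e z => if e.1 == t then e.2 else z) 0 (nth [::] s k)) d.

Definition qinv_check (n : nat) (N A : nat -> nat -> Q) : bool :=
  all (fun i => all (fun j =>
    Qeq_bool (qsum n (fun t => Qmult (N i t) (A t j)))
      (Qmake (if i == j then 1 else 0) 1)) (iota 0 n)) (iota 0 n).

Definition gent (e : nat * nat) (M : qmat) : Q := qentry M e.1 e.2.
Definition gval (t k : nat) : Q := gent (nth (0, 0)%N gpivots t) (nth [::] gms k).
(** The inverse of [gval], supplied as a witness and certified by [ginv_left] and [ginv_right]. *)
Definition ginv : nat -> nat -> Q := qsparse 6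
  [:: [:: (0%N, -6)]; [:: (1%N, -6)]; [:: (2%N, -6)]; [:: (5%N, 3)]; [:: (3%N, 3)];
      [:: (4%N, 3)]; [:: (6%N, 2); (10%N, 1)]; [:: (6%N, -1); (10%N, 1)];
      [:: (12%N, 1)]; [:: (13%N, -1)]; [:: (7%N, 1)]; [:: (8%N, -1)];
      [:: (11%N, 1)]; [:: (9%N, -1)]].

(* A component and a list of coordinates in which it is differentiated before
   evaluating at the origin. *)
Definition epivots : seq (nat * seq nat) :=
  [:: (3, [::]); (4, [::]); (0, [::]); (2, [::]); (1, [::]); (3, [:: 1]);
      (3, [:: 0]); (2, [:: 1]); (3, [:: 4]); (4, [:: 0]); (1, [:: 1]);
      (2, [:: 4]); (1, [:: 1; 1]); (1, [:: 0; 1])]%N.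
Definition evalue (t k : nat) : Q :=
  let e := nth (0, [::])%N epivots t in
  eat0 (foldr epd (ecoord (nth [::] efs k) e.1) e.2).
(** A left inverse of the matrix of Taylor coefficients [evalue], certified by [einv_left]. *)
Definition einv : nat -> nat -> Q := qsparse 72
  [:: [:: (7%N, (-48)); (9%N, 72); (12%N, (-72))];
   [:: (5%N, (-24)); (8%N, (-48))];
   [:: (1%N, 18); (9%N, 36); (12%N, (-18))];
   [:: (0%N, 24); (1%N, (-36)); (6%N, (-48)); (7%N, (-48)); (12%N, (-36))];
   [:: (6%N, 12); (7%N, 6); (9%N, (-9)); (12%N, 9)];
   [:: (5%N, (-12))];
   [:: (2%N, 18); (3%N, 6); (8%N, (-24)); (10%N, 24); (13%N, 48)];
   [:: (10%N, (-12)); (13%N, (-24))];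
   [:: (5%N, (-48)); (13%N, (-96))];
   [:: (6%N, (-16)); (7%N, (-24)); (9%N, 12); (11%N, (-32)); (12%N, (-12))];
   [:: (0%N, (-6)); (4%N, 6); (6%N, (-4)); (7%N, (-4)); (9%N, 6); (11%N, (-8)); (12%N, (-3))];
   [:: (2%N, (-6)); (5%N, 3); (8%N, 6); (10%N, (-6)); (13%N, (-6))];
   [:: (7%N, 2); (9%N, 3); (12%N, (-3))];
   [:: (12%N, 12)]].

(* The structure constants of the derivations, read off their 14 matrix entries. *)
Definition gstruct (i j : nat) : seq Q :=
  let M := qcomm (nth [::] gms i) (nth [::] gms j) in
  let v := mkseq (fun t => gent (nth (0, 0)%N gpivots t) M) 14 in
  mkseq (fun k => qsum 14 (fun t => Qmult (ginv k t) (nth Q0 v t))) 14.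

Definition ecomb (s : seq Q) (i : nat) : epoly :=
  epsum (mkseq (fun k => escale (nth Q0 s k) (ecoord (nth [::] efs k) i)) 14).

Definition edecomp (s : seq Q) (b : efield) : bool :=
  all (fun a => nilp (eadd (escale (Qmake (-1) 1) (ecomb s a)) (ecoord b a))) (iota 0 5).

(** The left inverse gives independence of the 14 derivations, the right inverse below that they
    span. *)
Lemma ginv_left : qinv_check 14 ginv gval. Proof. by vm_compute. Qed.
Lemma ginv_right : qinv_check 14 gval ginv. Proof. by vm_compute. Qed.
Lemma einv_left : qinv_check 14 einv evalue. Proof. by vm_compute. Qed.
(** The decisive comparison: the constants are computed from the derivations alone, and the brackets
    of all 196 pairs of symbolic fields are checked against them. *)
Lemma gstruct_edecomp : all (fun i => all (fun j =>
  edecomp (gstruct i j) (ebracket (nth [::] efs i) (nth [::] efs j)))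
  (iota 0 14)) (iota 0 14).
Proof. by vm_compute. Qed.

(** * Independence, spanning and brackets of the two frames *)

Section Frames.
Variable R : realType.
Local Notation pt := 'rV[R]_5.
Local Notation zorn := (R^o * 'rV[R]_3 * 'rV[R]_3 * R^o)%type.
Local Notation rq := (@R_of_Q R).

Lemma qinvP n N A (i j : 'I_n) : qinv_check n N A ->
  \sum_(t < n) rq (N i t) * rq (A t j) = (i == j)%:R.
Proof.
move=> /allP /(_ i); rewrite mem_iota add0n ltn_ord => /(_ isT).
move=> /allP /(_ j); rewrite mem_iota add0n ltn_ord => /(_ isT).
rewrite (R_of_Q_eq R) => /eqP; rewrite R_of_Q_qsum val_eqE.
under eq_bigr do rewrite R_of_Q_mul.
by move=> ->; case: eqP => _; [exact: R_of_Q1|exact: R_of_Q0].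
Qed.

(** Since [N A = 1], the vector [c] is [N] applied to [A c]. *)
Lemma qinv_eq0 n N A (c : 'I_n -> R) : qinv_check n N A ->
  (forall t : 'I_n, \sum_(k < n) c k * rq (A t k) = 0) -> forall i, c i = 0.
Proof.
move=> NA cA i; transitivity (\sum_(k < n) c k * (i == k)%:R).
  rewrite (bigD1 i) //= eqxx mulr1 big1 ?addr0 // => k.
  by rewrite eq_sym => /negbTE ->; rewrite mulr0.
under eq_bigr => k _ do rewrite -(qinvP i k NA) mulr_sumr.
rewrite exchange_big big1 // => t _.
transitivity (rq (N i t) * \sum_(k < n) c k * rq (A t k)).
  by rewrite mulr_sumr; apply: eq_bigr => k _; rewrite mulrCA.
by rewrite cA mulr0.
Qed.

Lemma eeval_at0 f : eeval f (0 : pt) = rq (eat0 f).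
Proof.
elim: f => [|[c [[[[[a b] i] j] k] l]] f IH]; first by rewrite eeval0 R_of_Q0.
rewrite eeval_cons IH /= /c_theta /c_x /c_phi /c_q /c_psi !mxE !mul0r !mulr0 addr0.
rewrite expR0 cos0 sin0 expr1n mul1r mulr1.
case: i => [|i] /=; last by rewrite exprS !mul0r mulr0 add0r.
case: j => [|j] /=; last by rewrite [_ ^+ j.+1]exprS !(mul0r, mulr0) add0r.
case: l => /=; first by rewrite mulr0 mulr0 add0r.
by rewrite !expr0 !mulr1 R_of_Q_red R_of_Q_add.
Qed.

(** The coefficients are arbitrary reals, whereas an [epoly] has rational ones, so the combination
    is differentiated term by term. *)
Lemma partial_comb n (c : 'I_n -> R) (f : 'I_n -> epoly) (s : seq 'I_5) :
  foldr (@partial R 5) (fun p => \sum_(k < n) c k * eeval (f k) p) s =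
  fun p => \sum_(k < n) c k * eeval (foldr epd (f k) (map val s)) p.
Proof.
elim: s => //= v s ->; apply/funext => p; rewrite /partial.
suff [_ <-//] : has_dir p (delta_mx 0 v)
    (fun p => \sum_(k < n) c k * eeval (foldr epd (f k) (map val s)) p)
    (\sum_(k < n) c k * eeval (epd v (foldr epd (f k) (map val s))) p).
elim: (index_enum _) => [|k r IH].
  rewrite big_nil (_ : (fun p => _) = fun=> 0); first exact: has_dir_cst.
  by apply/funext => q; rewrite big_nil.
rewrite big_cons (_ : (fun p => _) = fun q =>
  c k * eeval (foldr epd (f k) (map val s)) q +
  \sum_(j <- r) c j * eeval (foldr epd (f j) (map val s)) q).
  apply: has_dirD => //; apply: has_dirZ.
  by rewrite -{1}[v]inord_val; exact: has_dir_epd.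
by apply/funext => q; rewrite big_cons.
Qed.

Lemma partial_cst0 (s : seq 'I_5) : foldr (@partial R 5) (fun=> 0) s = fun=> 0.
Proof.
elim: s => //= v s ->; apply/funext => p.
by have [_] := has_dir_cst p (delta_mx 0 v) (0 : R).
Qed.

Definition vframe : 14.-tuple (pt -> pt) := tframe (@vbracket R 5) (S1 R) (S2 R) (S3 R).

Lemma tnth_vframe i : tnth vframe i = @feval R (nth [::] efs i).
Proof.
rewrite /vframe S1_feval S2_feval S3_feval -efsE.
by apply: (@tnth_tframe _ _ [::] (@feval R)) => x y; rewrite vbracket_feval.
Qed.

Lemma lin_indep_vframe : lin_indep vframe.
Proof.
move=> c c0; apply: (qinv_eq0 einv_left) => t.
rewrite /evalue; set e := nth _ _ _.
(* The pivots stay within the five coordinates, so the passage through [inord] changes no index. *)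
have [e1 e2] : (e.1 < 5)%N /\ all (fun v => v < 5)%N e.2.
  have := mem_nth (0, [::])%N (ltn_ord t : (t < size epivots)%N).
  have : all (fun e => (e.1 < 5)%N && all (fun v => v < 5)%N e.2) epivots by [].
  by move=> /allP/[apply]/andP.
have : (fun p : pt => \sum_(k < 14) c k * eeval (ecoord (nth [::] efs k) e.1) p) = fun=> 0.
  apply/funext => p; transitivity (lincomb vframe c p 0 (Ordinal e1)).
    rewrite /lincomb fct_sumE summxE; apply: eq_bigr => k _.
    by rewrite tnth_vframe !mxE.
  by rewrite c0 mxE.
(* Differentiating along [e.2] and evaluating at the origin turns the vanishing combination into row
   [t] of [evalue] applied to [c]. *)
move=> /(congr1 (fun f => foldr (@partial R 5) f (map inord e.2) 0)).
rewrite partial_comb partial_cst0; apply: etrans; apply: eq_bigr => k _.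
rewrite eeval_at0 -map_comp map_id_in // => v /(allP e2) v5.
by rewrite /= inordK.
Qed.

Definition gframe : 14.-tuple (zorn -> zorn) :=
  tframe (@commutator R _) (act (gmat 0)) (act (gmat 1)) (act (gmat 2)).

Lemma tnth_gframe i : tnth gframe i = act (nth [::] gms i).
Proof.
rewrite -gmsE.
by apply: (@tnth_tframe _ _ [::] (@act R)) => x y; rewrite commutator_act.
Qed.

Let lieG : lie_algebra (@commutator R _) (@split_g2 R).
Proof. exact: lie_algebra_derivations (@zorn_mulPl R) (@zorn_mulPr R). Qed.

Lemma split_g2_gframe i : split_g2 (tnth gframe i).
Proof.
have a0 := @act_gmat_derivation R 0 isT.
have a1 := @act_gmat_derivation R 1 isT.
have a2 := @act_gmat_derivation R 2 isT.
have br (x y : zorn -> zorn) : @split_g2 R x -> split_g2 y ->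
    split_g2 (commutator x y) by exact: lie_mem_br lieG _ _.
have a3 := br _ _ a0 a1; have a4 := br _ _ a1 a2; have a5 := br _ _ a2 a0.
case: i => -[|[|[|[|[|[|[|[|[|[|[|[|[|[|//]]]]]]]]]]]]]] i;
  rewrite (tnth_nth 0) /=; auto.
Qed.

Lemma linspan_sub_split_g2 : linspan gframe `<=` @split_g2 R.
Proof.
move=> _ [c _ <-]; rewrite /lincomb; elim: (index_enum _) => [|k r IH].
  by rewrite big_nil; exact: (lie_mem0 lieG).
rewrite big_cons; apply: (lie_memP lieG) => //; exact: split_g2_gframe.
Qed.

Lemma zentry_lincomb c e : e \in gpivots ->
  zentry (lincomb gframe c) e.1 e.2 =
  \sum_(k < 14) c k * rq (gent e (nth [::] gms k)).
Proof.
move=> eG.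
have /andP[e1 e2] : (e.1 < 8)%N && (e.2 < 8)%N.
  have : all (fun e => (e.1 < 8)%N && (e.2 < 8)%N) gpivots by [].
  by move/allP; apply.
rewrite /lincomb; elim: (index_enum _) => [|k r IH].
  rewrite !big_nil /zentry -[X in zcoord X _]/(0 : zorn).
  by rewrite -(subrr (0 : zorn)) zcoordB // subrr.
rewrite !big_cons -IH /zentry zcoordP // tnth_gframe.
by congr (_ * _ + _); exact: zcoord_act.
Qed.

Lemma mem_gpivots (t : 'I_14) : nth (0, 0)%N gpivots t \in gpivots.
Proof. by apply: mem_nth; exact: ltn_ord. Qed.

Lemma lin_indep_gframe : lin_indep gframe.
Proof.
move=> c c0; apply: (qinv_eq0 ginv_left) => t.
rewrite -zentry_lincomb ?mem_gpivots // c0 /zentry -[X in zcoord X _]/(0 : zorn).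
rewrite -(subrr (0 : zorn)) zcoordB ?subrr //.
by case: t => -[|[|[|[|[|[|[|[|[|[|[|[|[|[|//]]]]]]]]]]]]]].
Qed.

(** The coefficients are [ginv] applied to the pivot entries of [D]. As [gval ginv = 1], the
    combination has the same pivot entries as [D], and the difference is a derivation killed by
    [derivation_eq0]. *)
Lemma derivation_lincomb D : split_g2 D ->
  D = lincomb gframe (fun k => \sum_(t < 14) rq (ginv k t) *
    (let e := nth (0, 0)%N gpivots t in zentry D e.1 e.2)).
Proof.
move=> dD; set E := lincomb _ _.
have dE : split_g2 E by apply: linspan_sub_split_g2; exact: linspan_lincomb.
have dDE : split_g2 (D - E).
  by rewrite addrC -scaleN1r; exact: (lie_memP lieG).
apply/eqP; rewrite -subr_eq0; apply/eqP; apply: derivation_eq0 => // e eG.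
have [t ->] : exists t : 'I_14, e = nth (0, 0)%N gpivots t.
  have := eG; rewrite -index_mem => ti.
  by exists (Ordinal (ti : (index e gpivots < 14)%N)); rewrite nth_index.
have e1 : ((nth (0, 0)%N gpivots t).1 < 8)%N.
  by case: t => -[|[|[|[|[|[|[|[|[|[|[|[|[|[|//]]]]]]]]]]]]]].
rewrite [zentry _ _ _]zcoordB // -/(zentry E _ _) zentry_lincomb ?mem_gpivots //.
(* After the sums are exchanged, row [t] of [gval] meets column [u] of [ginv], so only [u = t]
   survives. *)
under eq_bigr do rewrite mulr_suml.
rewrite exchange_big (bigD1 t) //= [X in _ - (_ + X)]big1; last first.
  move=> u /negbTE ut.
  under eq_bigr do rewrite mulrAC -mulrA mulrC mulrAC -/(gval t _).
  by rewrite -mulr_suml (qinvP t u ginv_right) eq_sym ut mul0r.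
under eq_bigr do rewrite mulrAC -mulrA mulrC mulrAC -/(gval t _).
by rewrite -mulr_suml (qinvP t t ginv_right) eqxx mul1r addr0 subrr.
Qed.

Lemma linspan_gframe : linspan gframe = @split_g2 R.
Proof.
apply/seteqP; split=> [|D /derivation_lincomb ->]; first exact: linspan_sub_split_g2.
exact: linspan_lincomb.
Qed.

Let struct (i j k : 'I_14) : R := rq (nth Q0 (gstruct i j) k).

(** The commutator is a derivation, and [gstruct] was defined as the coefficients that
    [derivation_lincomb] assigns to it. *)
Lemma commutator_gframe i j :
  commutator (tnth gframe i) (tnth gframe j) = lincomb gframe (struct i j).
Proof.
rewrite [LHS]derivation_lincomb; last first.
  by apply: (lie_mem_br lieG); exact: split_g2_gframe.
congr lincomb; apply/funext => k; rewrite /struct /gstruct nth_mkseq //.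
rewrite R_of_Q_qsum; apply: eq_bigr => t _.
rewrite R_of_Q_mul nth_mkseq // !tnth_gframe commutator_act; congr (_ * _).
by case: t => -[|[|[|[|[|[|[|[|[|[|[|[|[|[|//]]]]]]]]]]]]]] t; exact: zcoord_act.
Qed.

Lemma vbracket_vframe i j :
  vbracket (tnth vframe i) (tnth vframe j) = lincomb vframe (struct i j).
Proof.
rewrite !tnth_vframe vbracket_feval /struct; apply/funext => p; apply/rowP => a.
rewrite mxE /lincomb fct_sumE summxE.
have : edecomp (gstruct i j) (ebracket (nth [::] efs i) (nth [::] efs j)).
  have /allP/(_ i) := gstruct_edecomp; rewrite mem_iota add0n ltn_ord => /(_ isT).
  by move=> /allP/(_ j); rewrite mem_iota add0n ltn_ord => /(_ isT).
move: (gstruct i j) (ebracket _ _) => s b /allP/(_ a).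
rewrite mem_iota add0n ltn_ord => /(_ isT)/nilP/(congr1 (fun f => eeval f p)).
rewrite eeval0 eeval_add eeval_scale.
rewrite [rq _]R_of_Q_Z divr1 mulN1r addrC => /eqP.
rewrite subr_eq0 => /eqP ->; rewrite eeval_psum big_map -[iota 0 14]/(index_iota 0 14).
rewrite big_mkord; apply: eq_bigr => k _.
by rewrite eeval_scale tnth_vframe !mxE.
Qed.

(** Fields in the span have differentiable components, where partial derivatives are linear;
    elsewhere this could fail. *)
Lemma vbracket_bilinear :
  bilinear_on (@vbracket R 5) (linspan vframe).
Proof.
have smooth X i p : linspan vframe X -> differentiable (Defs.coord X i) p.
  move=> [c _ <-].
  rewrite (_ : Defs.coord _ _ = fun p =>
    \sum_(k < 14) c k * eeval (ecoord (nth [::] efs k) i) p); last first.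
    apply/funext => q; rewrite /Defs.coord /lincomb fct_sumE summxE.
    by apply: eq_bigr => k _; rewrite tnth_vframe !mxE.
  elim: (index_enum _) => [|k r IH].
    rewrite (_ : (fun _ => _) = fun=> 0); first exact: differentiable_cst.
    by apply/funext => q; rewrite big_nil.
  rewrite (_ : (fun _ => _) = fun q => c k * eeval (ecoord (nth [::] efs k) i) q
    + \sum_(l <- r) c l * eeval (ecoord (nth [::] efs l) i) q).
    apply: differentiableD => //; apply: differentiableM; first exact: differentiable_cst.
    exact: differentiable_eeval.
  by apply/funext => q; rewrite big_cons.
have partialP k X Y i j p : linspan vframe X -> linspan vframe Y ->
    partial j (Defs.coord (k *: X + Y) i) p =
    k * partial j (Defs.coord X i) p + partial j (Defs.coord Y i) p.
  move=> sX sY; have dX := smooth X i p sX; have dY := smooth Y i p sY.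
  have hX : has_dir p (delta_mx 0 j) (Defs.coord X i) (partial j (Defs.coord X i) p) by [].
  have hY : has_dir p (delta_mx 0 j) (Defs.coord Y i) (partial j (Defs.coord Y i) p) by [].
  have [_ <-] := has_dirD (has_dirZ k hX) hY.
  apply: (congr1 (fun f => 'D_(delta_mx 0 j) f p)).
  by apply/funext => q; rewrite /Defs.coord !mxE.
have coordP k (X Y : pt -> pt) i p :
    Defs.coord (k *: X + Y) i p = k * Defs.coord X i p + Defs.coord Y i p.
  by rewrite /Defs.coord !mxE.
split=> k X Y Z sX sY sZ; apply/funext => p; apply/rowP => i;
  rewrite !mxE mulr_sumr -big_split /=; apply: eq_bigr => j _;
  rewrite partialP // !coordP; ring.
Qed.

End Frames.

Theorem theorem3p1 (R : realType) :
  pairwise_bracket_generates_split_g2 (S1 R) (S2 R) (S3 R).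
Proof.
rewrite /pairwise_bracket_generates_split_g2; set B := bracket_frame _ _ _.
(* Positions 6 and 7 are the only ones where the frame of the statement differs from [vframe]. *)
have i01 : Ordinal (isT : (6 < 14)%N) != Ordinal (isT : (7 < 14)%N) by [].
have a0 : 1 / 4 != 0 :> R by rewrite div1r invr_neq0 // pnatr_eq0.
have b0 : Num.sqrt 3 / 12 != 0 :> R.
  by rewrite mulf_neq0 ?invr_neq0 ?pnatr_eq0 // sqrtr_eq0 -ltNge ltr0n.
have B6 : tnth B (Ordinal (isT : (6 < 14)%N)) = (1 / 4 : R) *:
    (tnth (vframe R) (Ordinal (isT : (6 < 14)%N)) - tnth (vframe R) (Ordinal (isT : (7 < 14)%N))).
  by rewrite !(tnth_nth 0).
have B7 : tnth B (Ordinal (isT : (7 < 14)%N)) = (Num.sqrt 3 / 12 : R) *: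
    (tnth (vframe R) (Ordinal (isT : (6 < 14)%N)) + tnth (vframe R) (Ordinal (isT : (7 < 14)%N))).
  by rewrite !(tnth_nth 0).
have Boff i : i != Ordinal (isT : (6 < 14)%N) -> i != Ordinal (isT : (7 < 14)%N) ->
    tnth B i = tnth (vframe R) i.
  rewrite !(tnth_nth 0).
  by case: i => -[|[|[|[|[|[|[|[|[|[|[|[|[|[|//]]]]]]]]]]]]]].
(* Both spans are put in the form of the transfer lemma: the fields on the rational frame, split g2
   as the span of [gframe]. *)
rewrite (linspan_rotate i01 a0 b0 B6 B7 Boff) -linspan_gframe.
have lieG : lie_algebra (@commutator R _) (linspan (gframe R)).
  rewrite linspan_gframe.
  exact: lie_algebra_derivations (@zorn_mulPl R) (@zorn_mulPr R).
have [lieV iso] := lie_isomorphic_frames (@lin_indep_vframe R) (@lin_indep_gframe R)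
  (@vbracket_bilinear R) lieG (@vbracket_vframe R) (@commutator_gframe R).
split=> //.
  by rewrite S1_feval S2_feval S3_feval; split; exact: smooth_feval.
exact: lin_indep_rotate i01 a0 b0 B6 B7 Boff (@lin_indep_vframe R).
Qed.
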